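(* Let $\beta\ge1$. Fix $\zeta$ in $\partial D$ and analytic self-maps $\varphi$ and $\psi$ of $D$, both of which have sufficient data at $\zeta$, with respective orders of contact $2m$ and $2n$. Let $C_\varphi$ and $C_\psi$ act on $\mathcal{D}_\beta$. (i) If $n<m$, then $\|C_\varphi-C_\psi\|_e^2\ge\frac{1}{|\varphi'(\zeta)|^\beta}$. (ii) If $n=m$ and $D_{2m-1}(\varphi,\zeta)\ne D_{2m-1}(\psi,\zeta)$, then $$\|C_\varphi-C_\psi\|_e^2\ge\frac{1}{|\varphi'(\zeta)|^\beta}+\frac{1}{|\psi'(\zeta)|^\beta}.$$
   Context: $D$ is the open unit disk. For $\beta\ge1$, $\mathcal{D}_\beta$ is the reproducing kernel Hilbert space of analytic functions on $D$ with kernel functions $k_w(z)=(1-\overline{w}z)^{-\beta}$ ($\mathcal{D}_1=H^2$; for $\beta>1$ a weighted Bergman space). $C_\varphi f=f\circ\varphi$. $\|T\|_e$ is the operator-norm distance from $T$ to the compact operators. An analytic self-map $\varphi$ of $D$ has a finite angular derivative at $\zeta\in\partial D$ if the non-tangential limit $\varphi(\zeta)$ exists with $|\varphi(\zeta)|=1$ and $\varphi'(\zeta)=\lim_{\angle z\to\zeta}\frac{\varphi(z)-\varphi(\zeta)}{z-\zeta}$ exists finitely. $\varphi$ has $k$-th order data at $\zeta$ if there are complex $b_0,\ldots,b_k$ with $|b_0|=1$ and $\varphi(z)=\sum_{j=0}^k b_j(z-\zeta)^j+o(|z-\zeta|^k)$ as $z\to\zeta$ unrestrictedly in $D$; then $\varphi^{(j)}(\zeta):=j!\,b_j$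 and $D_k(\varphi,\zeta)=(\varphi(\zeta),\varphi'(\zeta),\ldots,\varphi^{(k)}(\zeta))$. $\varphi$ has order of contact $c>0$ at $\zeta$ if $|\varphi(\zeta)|=1$ and $\frac{1-|\varphi(e^{i\theta})|^2}{|\varphi(\zeta)-\varphi(e^{i\theta})|^c}$ is essentially bounded above and away from zero as $e^{i\theta}\to\zeta$ (boundary values are non-tangential limits). $\varphi$ has sufficient data at $\zeta$ if (i) it has finite angular derivative at $\zeta$; (ii) it has order of contact $2m$ at $\zeta$ for some natural number $m\ge1$; (iii) it has $2m$-th order data at $\zeta$. *)

(* Defs.v *)
From HB Require Import structures.
From mathcomp Require Import all_boot all_order all_algebra.
From mathcomp Require Import complex.
From mathcomp Require Import all_classical all_reals all_analysis.

Set Implicit Arguments.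
Unset Strict Implicit.
Unset Printing Implicit Defensive.

Import Order.TTheory GRing.Theory Num.Theory numFieldNormedType.Exports.

Local Open Scope classical_set_scope.
Local Open Scope ring_scope.

(* Typing R[i] as a numClosedFieldType makes the topology and the
   normed-module structure that every numFieldType carries available. *)
Definition Cx (R : realType) : numClosedFieldType := complex R.

(* The norm `|z| of Cx R is valued in Cx R; this is the real-valued modulus. *)
Definition cmod (R : realType) (z : Cx R) : R := ComplexField.Normc.normc z.

Definition expi (R : realType) (t : R) : Cx R := Complex (cos t) (sin t).

(* Principal branch of u ^ a for Re u > 0, where arg u = atan (Im u / Re u). *)
Definition rhp_power (R : realType) (u : Cx R) (a : R) : Cx R :=
  Complex (cmod u `^ a) 0 * expi (a * atan (complex.Im u / complex.Re u)).

Definition unit_disk (R : realType) : set (Cx R) := [set z | cmod z < 1].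
Arguments unit_disk : clear implicits.

(* Functions on the disk are represented by functions on the plane that vanish
   off the disk. *)
Definition on_disk (R : realType) (f : Cx R -> Cx R) : Cx R -> Cx R :=
  patch (fun=> 0) (unit_disk R) f.

Definition analytic (R : realType) (f : Cx R -> Cx R) : Prop :=
  forall z, unit_disk R z -> derivable f z 1.

(* Only the values on the disk matter; nothing below depends on the others. *)
Definition analytic_self_map (R : realType) (phi : Cx R -> Cx R) : Prop :=
  analytic phi /\ forall z, unit_disk R z -> unit_disk R (phi z).

(* A Hilbert space of analytic functions on the disk with reproducing kernel
   k_w = K w.  The space and its inner product are determined by K
   (Moore-Aronszajn).  The inner product is linear in its first argument, and
   its values outside the carrier are irrelevant. *)
Structure analytic_rkhs (R : realType) (K : Cx R -> Cx R -> Cx R) := AnalyticRKHS {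
  carrier : set (Cx R -> Cx R);
  inner : (Cx R -> Cx R) -> (Cx R -> Cx R) -> Cx R;
  carrier_support : forall f z, carrier f -> ~ unit_disk R z -> f z = 0;
  carrier_analytic : forall f, carrier f -> analytic f;
  carrier0 : carrier (fun=> 0);
  carrierP : forall (a : Cx R) f g, carrier f -> carrier g ->
    carrier (fun z => a * f z + g z);
  innerP : forall (a : Cx R) f g h, carrier f -> carrier g -> carrier h ->
    inner (fun z => a * f z + g z) h = a * inner f h + inner g h;
  inner_conj : forall f g, carrier f -> carrier g ->
    inner g f = Num.conj (inner f g);
  inner_ge0 : forall f, carrier f -> 0 <= inner f f;
  inner_eq0 : forall f, carrier f -> inner f f = 0 -> f = (fun=> 0);
  carrier_complete : forall u : nat -> Cx R -> Cx R,
    (forall n, carrier (u n)) ->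
    (forall e : R, 0 < e -> exists N : nat, forall i j, (N <= i)%N -> (N <= j)%N ->
       Num.sqrt (complex.Re (inner (u i - u j) (u i - u j))) < e) ->
    exists2 f, carrier f &
      Num.sqrt (complex.Re (inner (u n - f) (u n - f))) @[n --> \oo] --> (0 : R);
  carrier_kernel : forall w, unit_disk R w -> carrier (on_disk (K w));
  reproducing : forall f w, carrier f -> unit_disk R w ->
    inner f (on_disk (K w)) = f w
}.

Definition Dbeta_kernel (R : realType) (beta : R) (w z : Cx R) : Cx R :=
  rhp_power (1 - Num.conj w * z) (- beta).

Definition Dbeta (R : realType) (beta : R) := analytic_rkhs (Dbeta_kernel beta).

Definition hnorm (R : realType) (K : Cx R -> Cx R -> Cx R)
    (H : analytic_rkhs K) (f : Cx R -> Cx R) : R :=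
  Num.sqrt (complex.Re (inner H f f)).

Definition ehnorm (R : realType) (K : Cx R -> Cx R -> Cx R)
    (H : analytic_rkhs K) (f : Cx R -> Cx R) : \bar R :=
  if pselect (carrier H f) then (hnorm H f)%:E else +oo%E.

(* +oo when T does not map H boundedly into itself. *)
Definition opnorm (R : realType) (K : Cx R -> Cx R -> Cx R)
    (H : analytic_rkhs K) (T : (Cx R -> Cx R) -> (Cx R -> Cx R)) : \bar R :=
  ereal_sup [set ehnorm H (T f) | f in [set f | carrier H f /\ hnorm H f <= 1]].

Definition compact_operator (R : realType) (K : Cx R -> Cx R -> Cx R)
    (H : analytic_rkhs K) (Q : (Cx R -> Cx R) -> (Cx R -> Cx R)) : Prop :=
  [/\ forall f, carrier H f -> carrier H (Q f),
      forall (a : Cx R) f g, carrier H f -> carrier H g ->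
        Q (fun z => a * f z + g z) = (fun z => a * Q f z + Q g z) &
      forall u : nat -> Cx R -> Cx R,
        (forall n, carrier H (u n) /\ hnorm H (u n) <= 1) ->
        exists s : nat -> nat, {homo s : i j / (i < j)%N} /\
          exists2 g, carrier H g & hnorm H (Q (u (s n)) - g) @[n --> \oo] --> (0 : R)].

Definition essnorm (R : realType) (K : Cx R -> Cx R -> Cx R)
    (H : analytic_rkhs K) (T : (Cx R -> Cx R) -> (Cx R -> Cx R)) : \bar R :=
  ereal_inf [set opnorm H (fun f => T f - Q f) | Q in compact_operator H].

Definition comp_operator (R : realType) (phi f : Cx R -> Cx R) : Cx R -> Cx R :=
  on_disk (f \o phi).

Definition stolz_region (R : realType) (zeta : Cx R) (M : R) : set (Cx R) :=
  [set z | unit_disk R z /\ cmod (z - zeta) < M * (1 - cmod z)].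

Definition nontangential_limit (R : realType) (f : Cx R -> Cx R) (zeta l : Cx R)
    : Prop :=
  forall M : R, 1 < M ->
    f z @[z --> within (stolz_region zeta M) (nbhs zeta)] --> l.

Definition is_angular_derivative (R : realType) (phi : Cx R -> Cx R)
    (zeta d : Cx R) : Prop :=
  exists w : Cx R, [/\ cmod w = 1, nontangential_limit phi zeta w &
    nontangential_limit (fun z => (phi z - w) / (z - zeta)) zeta d].

Definition has_finite_angular_derivative (R : realType) (phi : Cx R -> Cx R)
    (zeta : Cx R) : Prop :=
  exists d, is_angular_derivative phi zeta d.

Definition angular_derivative (R : realType) (phi : Cx R -> Cx R)
    (zeta : Cx R) : Cx R :=
  xget 0 [set d | is_angular_derivative phi zeta d].

Definition data_coefficients (R : realType) (phi : Cx R -> Cx R) (zeta : Cx R)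
    (k : nat) (b : 'I_k.+1 -> Cx R) : Prop :=
  cmod (b ord0) = 1 /\
  (phi z - \sum_(j < k.+1) b j * (z - zeta) ^+ j) / (z - zeta) ^+ k
    @[z --> within (unit_disk R) (nbhs zeta)] --> (0 : Cx R).

Definition has_data (R : realType) (phi : Cx R -> Cx R) (zeta : Cx R) (k : nat)
    : Prop :=
  exists b : 'I_k.+1 -> Cx R, data_coefficients phi zeta b.

(* D_k(phi, zeta), that is the family j! b_j for j <= k. *)
Definition boundary_data (R : realType) (phi : Cx R -> Cx R) (zeta : Cx R)
    (k : nat) : 'I_k.+1 -> Cx R :=
  fun j => (j`!)%:R *
    xget (fun=> 0) [set b : 'I_k.+1 -> Cx R | data_coefficients phi zeta b] j.
Arguments boundary_data {R} phi zeta k.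

(* The boundary values phi(zeta) = w and phi(e^{it}) = l are non-tangential
   limits; the latter exist for almost every t by Fatou's theorem. *)
Definition has_order_of_contact (R : realType) (phi : Cx R -> Cx R)
    (zeta : Cx R) (c : R) : Prop :=
  0 < c /\ exists w : Cx R, [/\ nontangential_limit phi zeta w, cmod w = 1 &
    exists A B delta : R, [/\ 0 < A, 0 < delta &
      {ae (@lebesgue_measure R), forall t : R,
        cmod (expi t - zeta) < delta ->
        exists l : Cx R, nontangential_limit phi (expi t) l /\
          A <= (1 - cmod l ^+ 2) / (cmod (w - l) `^ c) <= B}]].

Definition sufficient_data (R : realType) (phi : Cx R -> Cx R) (zeta : Cx R)
    (m : nat) : Prop :=
  [/\ (1 <= m)%N, has_finite_angular_derivative phi zeta,
      has_order_of_contact phi zeta (2 * m)%N%:R & has_data phi zeta (2 * m)%N].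

(* Main.v *)
Require Import Defs.
From HB Require Import structures.
From mathcomp Require Import all_boot all_order all_algebra.
From mathcomp Require Import complex.
From mathcomp Require Import all_classical all_reals all_analysis.
From mathcomp Require Import ring lra.

Set Implicit Arguments.
Unset Strict Implicit.
Unset Printing Implicit Defensive.

Import Order.TTheory GRing.Theory Num.Theory numFieldNormedType.Exports.
Local Open Scope classical_set_scope.
Local Open Scope ring_scope.

(* Testing [C_phi - C_psi] against normalized differences of kernels bounds its
   essential norm from below by the upper limit, as [|w| -> 1], of
   [||k_phi(w) - k_psi(w)||^2 / ||k_w||^2], which is
   [((1-|w|^2)/(1-|phi|^2))^beta + ((1-|w|^2)/(1-|psi|^2))^beta] up to a cross
   term of modulus at most [2 ((1-|w|^2)/|1 - conj(phi) psi|)^beta].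

   Let [w] tend to [zeta] along points [r x], [|x| = 1], with
   [1 - r = M |x - zeta|^(2m)].  By contact of order [2m],
   [1 - |phi(w)| <= (|phi'(zeta)| + O(1/M)) (1 - r)].  If [n < m], then
   [1 - |psi(w)|] is of order [|x - zeta|^(2n)], much larger than [1 - r]; if
   [n = m] and the data differ, then [|phi(w) - psi(w)|] is at least of order
   [|x - zeta|^(2m-1)].  Either way the cross term vanishes; then let [M] tend
   to infinity.  The estimate for [psi] when [n < m] needs [psi'(zeta) <> 0];
   that Schwarz-Pick type fact is bypassed, because [psi'(zeta) = 0] together
   with [phi'(zeta) <> 0] makes the essential norm infinite, while for
   [phi'(zeta) = 0] the bound to prove is [1 / 0 = 0]. *)

(** * Modulus, conjugation and limits in the complex plane, in terms of the real-valued modulus *)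

Section Modulus.
Context {R : realType}.
Implicit Types (z w : Cx R) (x : R).

Definition ofR (x : R) : Cx R := Complex x 0.

Lemma ofRM x y : ofR (x * y) = ofR x * ofR y.
Proof. by apply/eqP; rewrite eq_complex /= !mul0r !mulr0 subr0 addr0 !eqxx. Qed.

Lemma normE z : `|z| = ofR (cmod z).
Proof. by case: z => a b. Qed.

Lemma cmod_ge0 z : 0 <= cmod z.
Proof. by case: z => a b; exact: sqrtr_ge0. Qed.

Lemma cmod0 : cmod (0 : Cx R) = 0. Proof. exact: ComplexField.Normc.normc0. Qed.
Lemma cmod1 : cmod (1 : Cx R) = 1. Proof. exact: ComplexField.Normc.normc1. Qed.
Lemma cmodM z w : cmod (z * w) = cmod z * cmod w.
Proof. exact: ComplexField.Normc.normcM. Qed.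
Lemma cmodV z : cmod (z^-1) = (cmod z)^-1. Proof. exact: ComplexField.Normc.normcV. Qed.
Lemma cmodN z : cmod (- z) = cmod z. Proof. exact: normcN. Qed.
Lemma cmodD z w : cmod (z + w) <= cmod z + cmod w. Proof. exact: le_normcD. Qed.
Lemma cmod_eq0 z : cmod z = 0 -> z = 0. Proof. exact: ComplexField.Normc.eq0_normc. Qed.
Lemma cmodX z n : cmod (z ^+ n) = cmod z ^+ n.
Proof. by elim: n => [|n IH]; rewrite ?expr0 ?cmod1 // !exprS cmodM IH. Qed.

Lemma conjE z : Num.conj z = Complex (complex.Re z) (- complex.Im z).
Proof. by case: z. Qed.

Lemma cmod_conj z : cmod (Num.conj z) = cmod z.
Proof. by rewrite conjE; case: z => a b; rewrite /cmod /= sqrrN. Qed.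

Lemma cmod_ofR x : cmod (ofR x) = `|x|.
Proof. by rewrite /cmod /= expr0n /= addr0 sqrtr_sqr. Qed.

Lemma cmod_expi x : cmod (expi x) = 1.
Proof. by rewrite /cmod /= cos2Dsin2 sqrtr1. Qed.

Lemma Re_le_cmod z : complex.Re z <= cmod z.
Proof.
case: z => a b; rewrite /cmod /=; apply: le_trans (ler_norm a) _.
by rewrite -sqrtr_sqr ler_sqrt ?addr_ge0 ?sqr_ge0 // lerDl sqr_ge0.
Qed.

Lemma ReD z w : complex.Re (z + w) = complex.Re z + complex.Re w.
Proof. by case: z; case: w. Qed.
Lemma ReN z : complex.Re (- z) = - complex.Re z.
Proof. by case: z. Qed.
Lemma Re_conj z : complex.Re (Num.conj z) = complex.Re z.
Proof. by case: z. Qed.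
Lemma Re_ofRM x z : complex.Re (ofR x * z) = x * complex.Re z.
Proof. by case: z => a b /=; rewrite mul0r subr0. Qed.

Lemma mul_conj z : z * Num.conj z = ofR (cmod z ^+ 2).
Proof.
case: z => a b; rewrite conjE /cmod /= sqr_sqrtr ?addr_ge0 ?sqr_ge0 //.
by apply/eqP; rewrite eq_complex /=; apply/andP; split; apply/eqP; ring.
Qed.

Lemma cmodB z w : cmod (z - w) = cmod (w - z).
Proof. by rewrite -cmodN opprB. Qed.

Lemma cmod_lerB z w : cmod z - cmod w <= cmod (z - w).
Proof. by rewrite lerBlDr -{1}(subrK w z) cmodD. Qed.

Lemma cmod_gt0 z : z != 0 -> 0 < cmod z.
Proof.
move=> z0; rewrite lt_neqAle cmod_ge0 andbT eq_sym.
by apply: contra z0 => /eqP /cmod_eq0 ->.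
Qed.

Lemma cmod_sqr z : cmod z ^+ 2 = complex.Re z ^+ 2 + complex.Im z ^+ 2.
Proof. by case: z => a b; rewrite /cmod /= sqr_sqrtr // addr_ge0 ?sqr_ge0. Qed.

(** The ball radii are elements of [Cx R], but a positive one has zero imaginary part, so real radii
    suffice. *)
Lemma nbhs_cmodP z (P : set (Cx R)) :
  nbhs z P <-> exists2 e : R, 0 < e & forall y, cmod (y - z) < e -> P y.
Proof.
split=> [/nbhs_ballP [e /= e0 he]|[e e0 he]].
- exists (complex.Re e); first by move: e0; rewrite ltcE => /andP[].
  move=> y hy; apply: he; rewrite -ball_normE /= distrC normE.
  move: e0; rewrite ltcE /= => /andP[/eqP ie re].
  by rewrite ltcE /= ie eqxx.
- apply/nbhs_ballP; exists (ofR e); first by rewrite /= ltcE /= eqxx.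
  move=> y; rewrite -ball_normE /= distrC normE ltcE /= eqxx /=.
  exact: he.
Qed.

Lemma cvg_within_cmodP (f : Cx R -> Cx R) (D : set (Cx R)) z l :
  f x @[x --> within D (nbhs z)] --> l <->
  forall e, 0 < e -> exists2 d : R, 0 < d &
    forall y, D y -> cmod (y - z) < d -> cmod (f y - l) < e.
Proof.
split=> [h e e0|h].
- have /h : nbhs l [set y | cmod (y - l) < e] by apply/nbhs_cmodP; exists e.
  rewrite /= nbhs_simpl /= /within => /nbhs_cmodP [d d0 hd].
  by exists d => // y Dy yd; exact: hd.
- move=> P /nbhs_cmodP [e e0 he]; rewrite /= nbhs_simpl /= /within.
  apply/nbhs_cmodP; have [d d0 hd] := h e e0.
  by exists d => // y yd Dy; apply: he; exact: hd.
Qed.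

End Modulus.

(** * Hilbert space geometry of a kernel space and weak convergence of normalized kernels *)

Section ReproducingKernel.
Context {R : realType} {K : Cx R -> Cx R -> Cx R} (H : analytic_rkhs K).
Implicit Types (f g h u : Cx R -> Cx R) (w z : Cx R).

Lemma on_diskE f z : unit_disk R z -> on_disk f z = f z.
Proof. by move=> Dz; rewrite /on_disk patchE mem_set. Qed.

Lemma carrierZ (a : Cx R) f : carrier H f -> carrier H (fun z => a * f z).
Proof.
move=> Hf; have := carrierP a Hf (carrier0 H).
by congr carrier; apply/funext => z; rewrite addr0.
Qed.

Lemma carrierB f g : carrier H f -> carrier H g -> carrier H (f - g).
Proof.
move=> Hf Hg; have := carrierP (-1) Hg Hf.
by congr carrier; apply/funext => z; rewrite mulN1r addrC.
Qed.

Lemma inner_ofR f : carrier H f -> inner H f f = ofR (complex.Re (inner H f f)).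
Proof.
move=> /inner_ge0; case: (inner H f f) => a b.
by rewrite lecE /= => /andP[/eqP -> _].
Qed.

Lemma Re_inner_ge0 f : carrier H f -> 0 <= complex.Re (inner H f f).
Proof. by move=> /inner_ge0; rewrite lecE /= => /andP[]. Qed.

Lemma hnorm_ge0 f : 0 <= hnorm H f. Proof. exact: sqrtr_ge0. Qed.

Lemma hnorm_sqr f : carrier H f -> hnorm H f ^+ 2 = complex.Re (inner H f f).
Proof. by move=> Hf; rewrite sqr_sqrtr // Re_inner_ge0. Qed.

Lemma inner0l g : carrier H g -> inner H (fun=> 0) g = 0.
Proof.
move=> Hg; have := innerP (-1) (carrier0 H) (carrier0 H) Hg.
rewrite (_ : (fun z => _) = (fun=> 0)); first by rewrite mulN1r addNr.
by apply/funext => z; rewrite mulr0 addr0.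
Qed.

Lemma innerZl (a : Cx R) f g : carrier H f -> carrier H g ->
  inner H (fun z => a * f z) g = a * inner H f g.
Proof.
move=> Hf Hg; have := innerP a Hf (carrier0 H) Hg.
rewrite inner0l // addr0 => <-; congr (inner H _ _).
by apply/funext => z; rewrite addr0.
Qed.

Lemma innerBl f g h : carrier H f -> carrier H g -> carrier H h ->
  inner H (f - g) h = inner H f h - inner H g h.
Proof.
move=> Hf Hg Hh; have := innerP (-1) Hg Hf Hh.
rewrite mulN1r addrC => <-; congr (inner H _ _).
by apply/funext => z; rewrite mulN1r addrC.
Qed.

Lemma hnorm_sqrP (a : Cx R) f g : carrier H f -> carrier H g ->
  hnorm H (fun z => a * f z + g z) ^+ 2 =
  cmod a ^+ 2 * hnorm H f ^+ 2 + 2 * complex.Re (a * inner H f g)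
  + hnorm H g ^+ 2.
Proof.
move=> Hf Hg; have Ha := carrierP a Hf Hg; rewrite !hnorm_sqr // innerP //.
rewrite (inner_conj Ha Hf) (inner_conj Ha Hg) !innerP // (inner_conj Hf Hg).
rewrite !rmorphD !rmorphM /= conjCK.
rewrite {1}[inner H f f]inner_ofR //.
rewrite !mulrDr !ReD Re_conj.
rewrite [Num.conj a * _]mulrC; set F := ofR _.
have -> : a * (Num.conj F * Num.conj a) = ofR (cmod a ^+ 2 * complex.Re (inner H f f)).
  rewrite ofRM -mul_conj /F; set x := complex.Re _.
  have -> : Num.conj (ofR x) = ofR x by rewrite conjE /= oppr0.
  by ring.
have -> : complex.Re (Num.conj a * Num.conj (inner H f g)) =
   complex.Re (a * inner H f g) by rewrite -rmorphM Re_conj.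
rewrite /=; ring.
Qed.

Lemma cauchy_schwarz f g : carrier H f -> carrier H g ->
  cmod (inner H f g) <= hnorm H f * hnorm H g.
Proof.
move=> Hf Hg; set c := inner H f g.
have [g0|g0] := eqVneq (hnorm H g) 0.
  have ig : inner H g g = 0.
    by rewrite inner_ofR // -hnorm_sqr // g0 expr0n.
  rewrite /c (inner_conj Hg Hf) (inner_eq0 Hg ig) inner0l // cmod_conj cmod0.
  by rewrite mulr_ge0 ?hnorm_ge0.
have gp : 0 < hnorm H g by rewrite lt_neqAle eq_sym g0 hnorm_ge0.
(* With [c = <f, g>] and [G = ||g||^2], the square [||c g - G f||^2 >= 0] expands to
   [G (G ||f||^2 - |c|^2)]. *)
set G := hnorm H g ^+ 2.
have := hnorm_sqrP (ofR (- G)) Hf (carrierZ c Hg).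
have -> : inner H f (fun z => c * g z) = ofR (cmod c ^+ 2).
  rewrite (inner_conj (carrierZ c Hg) Hf) innerZl // rmorphM /= -inner_conj //.
  by rewrite -/c mulrC mul_conj.
have -> : hnorm H (fun z => c * g z) ^+ 2 = cmod c ^+ 2 * G.
  have z0 := carrier0 H; have := hnorm_sqrP c Hg z0.
  rewrite [inner H g _](inner_conj z0 Hg) inner0l // rmorph0 mulr0.
  rewrite [hnorm H (fun=> 0) ^+ 2]hnorm_sqr ?inner0l //.
  rewrite /= mulr0 !addr0 => <-; congr (hnorm H _ ^+ 2).
  by apply/funext => z; rewrite addr0.
rewrite -ofRM cmod_ofR normrN -[complex.Re _]/(- G * cmod c ^+ 2).
have Gp : 0 < G by rewrite exprn_gt0.
rewrite [`|G|]gtr0_norm // => E.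
have : 0 <= G * (G * hnorm H f ^+ 2 - cmod c ^+ 2).
  by rewrite (_ : _ * _ = hnorm H (fun z => ofR (- G) * f z + c * g z) ^+ 2)
    ?sqr_ge0 // E; ring.
rewrite pmulr_rge0 // subr_ge0 /G -exprMn mulrC => h.
by rewrite -(@ler_pXn2r _ 2) // ?nnegrE ?mulr_ge0 ?hnorm_ge0 ?cmod_ge0.
Qed.

Lemma kernel_sqr w : unit_disk R w ->
  hnorm H (on_disk (K w)) ^+ 2 = complex.Re (K w w).
Proof.
move=> Dw; have kw := carrier_kernel H Dw.
by rewrite hnorm_sqr // reproducing // on_diskE.
Qed.

Lemma kernel_sqrB w z : unit_disk R w -> unit_disk R z ->
  hnorm H (on_disk (K w) - on_disk (K z)) ^+ 2 =
  complex.Re (K w w) + complex.Re (K z z) - 2 * complex.Re (K w z).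
Proof.
move=> Dw Dz; have kw := carrier_kernel H Dw; have kz := carrier_kernel H Dz.
have -> : on_disk (K w) - on_disk (K z) =
   (fun x => (-1) * on_disk (K z) x + on_disk (K w) x).
  by apply/funext => x; rewrite mulN1r addrC.
rewrite hnorm_sqrP // cmodN cmod1 expr1n mul1r !kernel_sqr //.
rewrite (inner_conj kw kz) reproducing // on_diskE //.
rewrite mulN1r ReN Re_conj; ring.
Qed.

Lemma eval_le f w : carrier H f -> unit_disk R w ->
  cmod (f w) <= hnorm H f * hnorm H (on_disk (K w)).
Proof.
move=> Hf Dw; have kw := carrier_kernel H Dw.
by rewrite -(reproducing Hf Dw); exact: cauchy_schwarz.
Qed.

(** As [f w = <f, k_w>], this says that the normalized kernels at [w k], paired with a carrier
    function [f], tend to zero. *)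
Definition null_along (w : nat -> Cx R) f := forall e : R, 0 < e ->
  exists N : nat, forall k, (N <= k)%N ->
    cmod (f (w k)) <= e * hnorm H (on_disk (K (w k))).

(* Otherwise summing suitable unimodular multiples of normalized kernels, each
   almost orthogonal to the previous sum, gives [u] with [||u||^2 <= 2N] and
   [Re <u, g> >= N d]; for large [N] this contradicts Cauchy-Schwarz. *)
Lemma null_along_carrier (w : nat -> Cx R) :
  (forall k, unit_disk R (w k)) ->
  (forall k, 0 < hnorm H (on_disk (K (w k)))) ->
  (forall j, null_along w (on_disk (K (w j)))) ->
  forall g, carrier H g -> null_along w g.
Proof.
move=> Dw kpos knull g Hg; apply: contrapT => /existsNP [d].
move=> /not_implyP [d0 /forallNP hd].
have bad N : exists2 k, (N <= k)%N &
    d * hnorm H (on_disk (K (w k))) < cmod (g (w k)).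
  have /existsNP [k /not_implyP [Nk /negP]] := hd N.
  by rewrite -ltNge => ?; exists k.
have build N : exists u, [/\ carrier H u, null_along w u,
    hnorm H u ^+ 2 <= 2 * N%:R & N%:R * d <= complex.Re (inner H u g)].
  elim: N => [|N [u [Hu nu uN ug]]].
    exists (fun=> 0); split.
    - exact: carrier0.
    - move=> e e0; exists 0%N => k _; rewrite cmod0.
      by rewrite mulr_ge0 ?hnorm_ge0 ?ltW.
    - by rewrite hnorm_sqr ?inner0l ?mulr0 //; exact: carrier0.
    - by rewrite inner0l // mul0r.
  (* Beyond [k0] the pairing of [u] with a normalized kernel is at most one half, so adding a
     unimodular multiple of one raises [||u||^2] by at most 2. *)
  have [k0 hk0] := nu (2^-1) ltac:(by rewrite invr_gt0).
  have [k kk0 gk] := bad k0.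
  have uk := hk0 k kk0.
  set e := on_disk (K (w k)) in gk uk.
  set n := hnorm H e in gk uk.
  have np : 0 < n := kpos k.
  have He : carrier H e by apply: carrier_kernel.
  have ge : inner H e g = Num.conj (g (w k)).
    by rewrite (inner_conj Hg He) reproducing.
  set c := cmod (g (w k)) in gk.
  have cp : 0 < c by apply: lt_trans gk; rewrite mulr_gt0.
  (* The phase of [a] turns [<a e, g>] into the positive number [c / n > d]; its modulus makes [a e]
     a unit vector. *)
  pose a := ofR ((c * n)^-1) * g (w k).
  have ca : cmod a = n^-1.
    rewrite cmodM cmod_ofR gtr0_norm ?invr_gt0 ?mulr_gt0 // -/c.
    by rewrite invfM mulrAC mulVf ?mul1r ?gt_eqF.
  exists (fun z => a * e z + u z); split.
  - exact: carrierP.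
  - move=> t t0.
    have t2 : 0 < n * (t / 2) by rewrite mulr_gt0 // divr_gt0.
    have [N1 h1] := knull k _ t2.
    have [N2 h2] := nu (t / 2) ltac:(by rewrite divr_gt0).
    exists (maxn N1 N2) => j; rewrite geq_max => /andP[j1 j2].
    apply: le_trans (cmodD _ _) _; rewrite cmodM ca.
    have := h1 _ j1; have := h2 _ j2.
    set nj := hnorm H _ => q2 q1.
    have {}q1 : n^-1 * cmod (e (w j)) <= t / 2 * nj.
      by rewrite ler_pdivrMl // mulrA.
    by apply: le_trans (lerD q1 q2) _; rewrite -mulrDl -splitr.
  - rewrite hnorm_sqrP // ca -/n exprVn mulVf ?expf_neq0 ?gt_eqF //.
    have q : complex.Re (a * inner H e u) <= 2^-1.
      apply: le_trans (Re_le_cmod _) _.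
      rewrite cmodM ca (inner_conj Hu He) cmod_conj reproducing //.
      by rewrite ler_pdivrMl // mulrC.
    by rewrite -natr1; lra.
  - rewrite innerP // ReD ge /a -mulrA mul_conj -/c Re_ofRM /=.
    have q : d <= (c * n)^-1 * c ^+ 2.
      rewrite (_ : (c * n)^-1 * c ^+ 2 = c / n); last first.
        by rewrite invfM expr2 mulrACA mulVf ?gt_eqF // mul1r mulrC.
      by rewrite ler_pdivlMr // ltW.
    by rewrite -natr1 mulrDl mul1r addrC; exact: lerD.
have [M hM] : exists M : nat, 2 * (hnorm H g / d) ^+ 2 < M%:R.
  by exists (Num.bound (2 * (hnorm H g / d) ^+ 2)); apply: archi_boundP;
    rewrite mulr_ge0 ?sqr_ge0.
have Mp : 0 < M%:R :> R.
  by apply: le_lt_trans hM; rewrite mulr_ge0 ?sqr_ge0.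
have [u [Hu _ uM ug]] := build M.
have l1 : M%:R * d <= hnorm H u * hnorm H g.
  by apply: le_trans ug _; apply: le_trans (Re_le_cmod _) (cauchy_schwarz _ _).
have l2 : (M%:R * d) ^+ 2 <= (hnorm H u * hnorm H g) ^+ 2.
  by rewrite ler_pXn2r ?nnegrE ?mulr_ge0 ?hnorm_ge0 // ltW.
have l3 : (M%:R * d) ^+ 2 <= 2 * M%:R * hnorm H g ^+ 2.
  by apply: le_trans l2 _; rewrite exprMn ler_wpM2r ?sqr_ge0.
have l4 : M%:R <= 2 * (hnorm H g / d) ^+ 2.
  rewrite -(ler_pM2l Mp) expr_div_n -(ler_pM2r (exprn_gt0 2 d0)).
  rewrite (_ : _ * _ * d ^+ 2 = (M%:R * d) ^+ 2); last by ring.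
  suff -> : M%:R * (2 * (hnorm H g ^+ 2 / d ^+ 2)) * d ^+ 2 = 2 * M%:R * hnorm H g ^+ 2 by [].
  by field; rewrite gt_eqF.
by rewrite ltNge l4 in hM.
Qed.

End ReproducingKernel.

(** * Essential norm of a difference of composition operators, tested on kernels *)

Section EssentialNorm.
Context {R : realType} {K : Cx R -> Cx R -> Cx R} (H : analytic_rkhs K).

(* For [f] the normalization of [k_phi(w) - k_psi(w)] one has
   [||k_phi(w) - k_psi(w)|| = (C_phi f - C_psi f)(w)].  The compact part is
   negligible there, since [Q f_k] subconverges in norm and the normalized
   kernels tend weakly to zero. *)
Lemma essnorm_ge (phi psi : Cx R -> Cx R) (w : nat -> Cx R) (L : R) :
  (forall z, unit_disk R z -> unit_disk R (phi z)) ->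
  (forall z, unit_disk R z -> unit_disk R (psi z)) ->
  (forall k, unit_disk R (w k)) ->
  (forall k, 0 < hnorm H (on_disk (K (w k)))) ->
  (forall j, null_along H w (on_disk (K (w j)))) ->
  (forall k, L * hnorm H (on_disk (K (w k))) <=
     hnorm H (on_disk (K (phi (w k))) - on_disk (K (psi (w k))))) ->
  (L%:E <= essnorm H (fun f => comp_operator phi f - comp_operator psi f)%R)%E.
Proof.
move=> Dphi Dpsi Dw kpos knull hL.
apply: le_ereal_inf_tmp => _ [Q [QH _ Qc] <-].
rewrite leNgt; apply/negP => hN.
set N := opnorm _ _ in hN.
have Nub f : carrier H f -> hnorm H f <= 1 ->
    (ehnorm H (comp_operator phi f - comp_operator psi f - Q f)%R <= N)%E.
  by move=> Hf f1; apply: ereal_sup_ubound => /=; exists f; first by split.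
have ehge0 f : (0 <= ehnorm H f)%E.
  by rewrite /ehnorm; case: pselect => Hf //; rewrite lee_fin hnorm_ge0.
have h0 : hnorm H (fun=> 0) = 0.
  by rewrite /hnorm inner0l ?sqrtr0 //; exact: carrier0.
have N0 : (0 <= N)%E.
  apply: le_trans (ehge0 _) (Nub (fun=> 0) (carrier0 H) _).
  by rewrite h0 ler01.
have [r rE] : exists r : R, N = r%:E.
  by move: hN N0; case: N {Nub} => [r| |] // _ _; exists r.
rewrite rE lte_fin in hN; rewrite rE lee_fin in N0.
pose D k := on_disk (K (phi (w k))) - on_disk (K (psi (w k))).
have HD k : carrier H (D k).
  by apply: carrierB; apply: carrier_kernel; [exact: Dphi|exact: Dpsi].
have Dpos k : 0 < hnorm H (D k).
  by apply: lt_le_trans (hL k); rewrite mulr_gt0 //; apply: le_lt_trans hN.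
pose f k : Cx R -> Cx R := fun z => ofR (hnorm H (D k))^-1 * D k z.
have Hf k : carrier H (f k) by exact: carrierZ.
have f1 k : hnorm H (f k) <= 1.
  suff : hnorm H (f k) ^+ 2 <= 1 ^+ 2.
    by rewrite ler_pXn2r ?nnegrE ?hnorm_ge0 ?ler01.
  rewrite hnorm_sqr // innerZl // (inner_conj (Hf k) (HD k)) innerZl //.
  rewrite inner_ofR // -hnorm_sqr // rmorphM /=.
  rewrite !(oppr0, mul0r, mulr0, subr0) expr1n expr2.
  by rewrite mulKf ?gt_eqF // mulVf ?gt_eqF.
have feval k : f k (phi (w k)) - f k (psi (w k)) = ofR (hnorm H (D k)).
  rewrite -(reproducing (Hf k) (Dphi _ (Dw k))).
  rewrite -(reproducing (Hf k) (Dpsi _ (Dw k))).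
  have k1 := carrier_kernel H (Dphi _ (Dw k)).
  have k2 := carrier_kernel H (Dpsi _ (Dw k)).
  rewrite (inner_conj k1 (Hf k)) (inner_conj k2 (Hf k)) -rmorphB /=.
  rewrite -innerBl // -/(D k) -inner_conj // innerZl // inner_ofR // -hnorm_sqr //.
  by rewrite -ofRM expr2 mulKf ?gt_eqF.
have [s [smono [g Hg gcvg]]] := Qc f (fun k => conj (Hf k) (f1 k)).
have gnull := null_along_carrier Dw kpos knull Hg.
(* The three errors [r], [e], [e] below sum to [(L + r) / 2 < L]. *)
pose e := (L - r) / 4.
have e0 : 0 < e by rewrite divr_gt0 // subr_gt0.
have [N1 hN1] := gnull e e0.
have [N2 hN2] : exists N2 : nat, forall n, (N2 <= n)%N ->
    hnorm H (Q (f (s n)) - g) <= e.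
  move/cvgrPdist_le : gcvg => /(_ e e0) [N2 _ h].
  exists N2 => n Nn; have := h n Nn.
  by rewrite /= sub0r normrN ger0_norm ?hnorm_ge0.
(* Since [n <= s n], one large [n] serves both the subsequence [s] and the full sequence [w]. *)
have sge n : (n <= s n)%N.
  elim: n => // n IH; apply: leq_ltn_trans IH _; exact: smono.
pose n := maxn N1 N2; pose k := s n.
have N1k : (N1 <= k)%N by apply: leq_trans (leq_maxl _ _) (sge n).
have N2n : (N2 <= n)%N := leq_maxr _ _.
set kn := hnorm H (on_disk (K (w k))).
have a1 : cmod (g (w k)) <= e * kn := hN1 k N1k.
have a2 : cmod ((Q (f k) - g) (w k)) <= e * kn.
  apply: le_trans (eval_le (carrierB (QH _ (Hf k)) Hg) (Dw k)) _.
  by rewrite ler_wpM2r ?hnorm_ge0 // hN2.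
have a3 : cmod ((comp_operator phi (f k) - comp_operator psi (f k) - Q (f k)) (w k))
    <= r * kn.
  have := Nub _ (Hf k) (f1 k); rewrite rE /ehnorm.
  case: pselect => [HT|//]; rewrite lee_fin => hT.
  apply: le_trans (eval_le HT (Dw k)) _.
  by rewrite ler_wpM2r ?hnorm_ge0.
(* The value of [(C_phi - C_psi) f_k] at [w k] is the sum of the values of
   [(C_phi - C_psi - Q) f_k], [Q f_k - g] and [g]. *)
have : hnorm H (D k) <= r * kn + (e * kn + e * kn).
  rewrite -[hnorm H (D k)]ger0_norm ?hnorm_ge0 // -cmod_ofR -feval.
  apply: le_trans _ (lerD a3 (lerD a2 a1)).
  apply: le_trans _ (lerD (lexx _) (cmodD _ _)).
  apply: le_trans _ (cmodD _ _).
  rewrite le_eqVlt; apply/orP; left; apply/eqP; congr cmod.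
  rewrite /= /comp_operator !fctE !on_diskE //=; ring.
have kp : 0 < kn := kpos k.
have := hL k; rewrite -/kn -/(D k) => b1 b2.
have : L * kn <= (r + (e + e)) * kn.
  by apply: le_trans b1 _; rewrite !mulrDl.
by rewrite ler_pM2r // /e; lra.
Qed.

End EssentialNorm.

(** * Size of the kernels of the weighted spaces *)

Section DbetaKernel.
Context {R : realType} (beta : R) (beta_gt0 : 0 < beta) (H : Dbeta beta).
Implicit Types (z w : Cx R).

Lemma cmod_Dbeta_kernel w z :
  cmod (Dbeta_kernel beta w z) = cmod (1 - Num.conj w * z) `^ (- beta).
Proof.
rewrite /Dbeta_kernel /rhp_power cmodM cmod_expi mulr1.
by rewrite -[Complex _ _]/(ofR _) cmod_ofR ger0_norm // powR_ge0.
Qed.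

Lemma Re_Dbeta_kernel w : unit_disk R w ->
  complex.Re (Dbeta_kernel beta w w) = (1 - cmod w ^+ 2) `^ (- beta).
Proof.
move=> Dw; have w1 : 0 <= 1 - cmod w ^+ 2.
  by rewrite subr_ge0 exprn_ile1 ?cmod_ge0 // ltW.
rewrite /Dbeta_kernel /rhp_power [Num.conj w * w]mulrC mul_conj.
have -> : 1 - ofR (cmod w ^+ 2) = ofR (1 - cmod w ^+ 2).
  by apply/eqP; rewrite eq_complex /= oppr0 addr0 !eqxx.
rewrite cmod_ofR ger0_norm //= mul0r atan0 mulr0 cos0 sin0.
by rewrite mulr0 subr0 mulr1.
Qed.

Lemma one_sub_sqr_gt0 w : unit_disk R w -> 0 < 1 - cmod w ^+ 2.
Proof.
by rewrite /unit_disk /= => Dw; rewrite subr_gt0 exprn_ilt1 ?cmod_ge0.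
Qed.

Lemma one_sub_conjM_gt0 w z : unit_disk R w -> unit_disk R z ->
  0 < cmod (1 - Num.conj w * z).
Proof.
rewrite /unit_disk /= => Dw Dz; apply: lt_le_trans _ (cmod_lerB _ _).
rewrite cmod1 cmodM cmod_conj subr_gt0.
have := cmod_ge0 w; have := cmod_ge0 z; nra.
Qed.

Lemma kernel_gt0 w : unit_disk R w ->
  0 < hnorm H (on_disk (Dbeta_kernel beta w)).
Proof.
move=> Dw; rewrite lt_neqAle hnorm_ge0 andbT eq_sym; apply/eqP => h0.
have := kernel_sqr H Dw; rewrite h0 expr0n Re_Dbeta_kernel //= => /esym /eqP.
by rewrite gt_eqF // powR_gt0 // one_sub_sqr_gt0.
Qed.

End DbetaKernel.

(** * Continuity estimates for real powers *)

Section PowerEstimates.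
Context {R : realType} (beta : R) (beta_gt0 : 0 < beta).

Lemma powR_le (x y : R) : 0 <= x -> x <= y -> x `^ beta <= y `^ beta.
Proof.
move=> x0 xy; apply: (ge0_ler_powR (ltW beta_gt0)); rewrite // nnegrE //.
exact: le_trans xy.
Qed.

Lemma powR_small (e : R) : 0 < e ->
  exists2 d : R, 0 < d & forall x, 0 <= x -> x <= d -> x `^ beta <= e.
Proof.
move=> e0; exists (e `^ beta^-1); first by rewrite powR_gt0.
move=> x x0 xd; rewrite -[leRHS]powRr1 ?(ltW e0) //.
by rewrite -(mulVf (lt0r_neq0 beta_gt0)) powRrM; exact: powR_le.
Qed.

Lemma powR_div (x y : R) : 0 <= x -> 0 < y ->
  (x / y) `^ beta = x `^ beta * y `^ (- beta).
Proof.
move=> x0 y0; rewrite powRM ?invr_ge0 ?(ltW y0) // -powR_inv1 ?(ltW y0) //.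
by rewrite -powRrM mulN1r.
Qed.

(** Here [y / x >= 1 / (a + d)], so continuity of the power at [1 / a] gives the bound; [d] is
    chosen with [(a + d)^(-beta) = v]. For [a = 0] the convention [1 / 0 = 0] makes the left side
    negative. *)
Lemma powR_ratio_ge (a e : R) : 0 <= a -> 0 < e ->
  exists2 d : R, 0 < d & forall x y, 0 < x -> 0 < y ->
    x <= (a + d) * y -> 1 / a `^ beta - e <= (y / x) `^ beta.
Proof.
move=> a0 e0.
have [v0|v0] := leP (1 / a `^ beta - e) 0.
  by exists 1 => // x y _ _ _; apply: le_trans v0 (powR_ge0 _ _).
set v := _ - e in v0 *.
have ap : 0 < a.
  rewrite lt_neqAle a0 andbT; apply/eqP => a00; move: v0.
  by rewrite /v -a00 powR0 ?gt_eqF // invr0 mulr0; lra.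
pose c := v `^ beta^-1.
have cp : 0 < c by rewrite powR_gt0.
have cv : c `^ beta = v by rewrite -powRrM mulVf ?gt_eqF // powRr1 // ltW.
have ca : a < c^-1.
  rewrite ltNge; apply/negP => h.
  have : a^-1 <= c by rewrite -[c]invrK lef_pV2 ?posrE ?invr_gt0.
  move=> /powR_le; rewrite invr_ge0 => /(_ a0); rewrite cv.
  rewrite -powR_inv1 // -powRrM mulN1r powRN /v; lra.
exists (c^-1 - a); first by rewrite subr_gt0.
move=> x y x0 y0; rewrite subrKC => xy; rewrite -cv.
apply: powR_le; first exact: ltW.
by rewrite ler_pdivlMr // -ler_pdivlMl.
Qed.

End PowerEstimates.

(** * From ratios of kernel norms at disk points to bounds on the squared essential norm *)

Section DbetaLowerBound.
Context {R : realType} (beta : R) (beta_gt0 : 0 < beta) (H : Dbeta beta).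
Context (phi psi : Cx R -> Cx R)
  (Dphi : forall z, unit_disk R z -> unit_disk R (phi z))
  (Dpsi : forall z, unit_disk R z -> unit_disk R (psi z)).

(** A fixed kernel is bounded on the disk, by [(1 - |w_j|)^(-beta)], whereas
    [||k_w||^2 = (1 - |w|^2)^(-beta)] tends to infinity along the sequence. *)
Lemma Dbeta_kernel_null (w : nat -> Cx R) : (forall k, unit_disk R (w k)) ->
  (forall e, 0 < e -> exists N : nat, forall k, (N <= k)%N -> 1 - cmod (w k) < e) ->
  forall j, null_along H w (on_disk (Dbeta_kernel beta (w j))).
Proof.
move=> Dw w1 j e e0.
have wj : 0 < 1 - cmod (w j) by rewrite subr_gt0; exact: Dw.
pose A := (1 - cmod (w j)) `^ (- beta) / e.
have Ap : 0 < A by rewrite divr_gt0 // powR_gt0.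
have [d d0 hd] := powR_small beta_gt0 (e := (A ^+ 2)^-1) ltac:(by rewrite invr_gt0 exprn_gt0).
have [N hN] := w1 (d / 2) ltac:(by rewrite divr_gt0).
exists N => k /hN wk; rewrite on_diskE // cmod_Dbeta_kernel.
have p := one_sub_sqr_gt0 (Dw k).
have Dk : cmod (w k) < 1 := Dw k.
have wk0 := cmod_ge0 (w k).
have l1 : (1 - cmod (w k) ^+ 2) `^ beta <= (A ^+ 2)^-1.
  apply: hd; first exact: ltW.
  by rewrite expr2; nra.
have l2 : A <= hnorm H (on_disk (Dbeta_kernel beta (w k))).
  rewrite -(@ler_pXn2r _ 2) ?nnegrE ?hnorm_ge0 ?(ltW Ap) //.
  rewrite kernel_sqr // Re_Dbeta_kernel // powRN.
  by rewrite -[leLHS]invrK lef_pV2 ?posrE ?invr_gt0 ?exprn_gt0 ?powR_gt0.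
apply: (@le_trans _ _ (e * A)); last by rewrite ler_pM2l.
rewrite /A [e * _]mulrC divfK ?gt_eqF // !powRN.
have c0 := one_sub_conjM_gt0 (Dw j) (Dw k).
rewrite lef_pV2 ?posrE ?powR_gt0 //.
apply: powR_le => //; first exact: ltW.
apply: le_trans _ (cmod_lerB _ _); rewrite cmod1 cmodM cmod_conj.
have := cmod_ge0 (w j); nra.
Qed.

(** A lower bound for [||k_phi(w) - k_psi(w)||^2 / ||k_w||^2]: the real part in the cross term is
    replaced by the modulus. *)
Definition kernel_ratio (w : Cx R) : R :=
  ((1 - cmod w ^+ 2) / (1 - cmod (phi w) ^+ 2)) `^ beta
  + ((1 - cmod w ^+ 2) / (1 - cmod (psi w) ^+ 2)) `^ beta
  - 2 * ((1 - cmod w ^+ 2) / cmod (1 - Num.conj (phi w) * psi w)) `^ beta.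

Let E := essnorm H (fun f => comp_operator phi f - comp_operator psi f).

(** Points with [1 - |w_k| < 1 / (k + 1)] feed [essnorm_ge] with the constant [Num.sqrt L]. For
    [L <= 0] this root is 0 and the claim reduces to nonnegativity of the square. *)
Lemma essnorm_sqr_ge (L : R) :
  (forall d, 0 < d -> exists w, [/\ unit_disk R w, 1 - cmod w < d &
     L <= kernel_ratio w]) ->
  (L%:E <= E ^+ 2)%E.
Proof.
move=> hw.
have /choice [w hwk] : forall k : nat, exists w, [/\ unit_disk R w,
    1 - cmod w < k.+1%:R^-1 & L <= kernel_ratio w].
  by move=> k; apply: hw; rewrite invr_gt0.
have Dw k : unit_disk R (w k) by case: (hwk k).
have wnull e : 0 < e -> exists N : nat, forall k, (N <= k)%N -> 1 - cmod (w k) < e.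
  move=> e0; exists (Num.bound e^-1) => k Nk; have [_ wk _] := hwk k.
  apply: lt_trans wk _; rewrite -[e]invrK ltf_pV2 ?posrE ?invr_gt0 //.
  apply: lt_le_trans (archi_boundP _) _; first by rewrite invr_ge0 ltW.
  by rewrite ler_nat ltnW.
have sE : ((Num.sqrt L)%:E <= E)%E.
  apply: (essnorm_ge (H := H) Dphi Dpsi Dw).
  - by move=> k; exact: kernel_gt0.
  - exact: Dbeta_kernel_null.
  move=> k; have [_ _ Lk] := hwk k.
  have [L0|L0] := leP L 0; first by rewrite ler0_sqrtr // mul0r hnorm_ge0.
  rewrite -(@ler_pXn2r _ 2) ?nnegrE ?hnorm_ge0 ?mulr_ge0 ?sqrtr_ge0 ?hnorm_ge0 //.
  have Dp := Dphi (Dw k); have Dq := Dpsi (Dw k).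
  rewrite exprMn sqr_sqrtr ?(ltW L0) // kernel_sqr // kernel_sqrB //.
  have := Re_le_cmod (Dbeta_kernel beta (phi (w k)) (psi (w k))).
  rewrite cmod_Dbeta_kernel; set X := complex.Re _ => q.
  rewrite (Re_Dbeta_kernel _ Dp) (Re_Dbeta_kernel _ Dq) (Re_Dbeta_kernel _ (Dw k)).
  have p := one_sub_sqr_gt0 (Dw k).
  move: Lk; rewrite /kernel_ratio !powR_div ?(ltW p) ?one_sub_sqr_gt0
    ?one_sub_conjM_gt0 //.
  rewrite [(1 - cmod (w k) ^+ 2) `^ (- beta)]powRN ler_pdivrMr ?powR_gt0 //.
  move=> /le_trans; apply.
  rewrite mulrCA -mulrDr -mulrBr [leRHS]mulrC ler_pM2l ?powR_gt0 //.
  lra.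
have s0 : (0 <= (Num.sqrt L)%:E)%E by rewrite lee_fin sqrtr_ge0.
have [L0|L0] := leP L 0.
  by apply: (@le_trans _ _ 0%E); rewrite ?lee_fin // expe2 mule_ge0 // (le_trans s0).
rewrite -[L]sqr_sqrtr ?(ltW L0) // EFin_expe !expe2; exact: lee_pmul.
Qed.

(** The [psi] term of [kernel_ratio] is nonnegative and dropped; the error [e] is spent half on the
    [phi] term and half on the doubled cross term. Later [a] is [|phi'(zeta)|]. *)
Lemma essnorm_sqr_ge1 (a : R) : 0 <= a ->
  (forall e d, 0 < e -> 0 < d -> exists w, [/\ unit_disk R w, 1 - cmod w < d,
     1 - cmod (phi w) ^+ 2 <= (a + e) * (1 - cmod w ^+ 2) &
     1 - cmod w ^+ 2 <= e * cmod (1 - Num.conj (phi w) * psi w)]) ->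
  ((1 / a `^ beta)%:E <= E ^+ 2)%E.
Proof.
move=> a0 hw; apply/lee_subgt0Pr => e e0; rewrite -EFinB.
have [d1 d10 h1] := powR_ratio_ge beta_gt0 a0 (e := e / 2) ltac:(by rewrite divr_gt0).
have [d2 d20 h2] := powR_small beta_gt0 (e := e / 4) ltac:(by rewrite divr_gt0).
apply: essnorm_sqr_ge => d d0.
have m0 : 0 < Num.min d1 d2 by rewrite lt_min d10.
have [w [Dw wd q1 q2]] := hw _ d m0 d0; exists w; split=> //.
have p := one_sub_sqr_gt0 Dw; have pp := one_sub_sqr_gt0 (Dphi Dw).
have pc := one_sub_conjM_gt0 (Dphi Dw) (Dpsi Dw).
have r1 : 1 / a `^ beta - e / 2 <= ((1 - cmod w ^+ 2) / (1 - cmod (phi w) ^+ 2)) `^ beta.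
  apply: h1 => //; apply: le_trans q1 _.
  by rewrite ler_pM2r // lerD2l ge_min lexx.
have r2 : ((1 - cmod w ^+ 2) / cmod (1 - Num.conj (phi w) * psi w)) `^ beta <= e / 4.
  apply: h2; first by rewrite divr_ge0 ?ltW.
  rewrite ler_pdivrMr //; apply: le_trans q2 _.
  by rewrite ler_pM2r // ge_min lexx orbT.
have r3 : 0 <= ((1 - cmod w ^+ 2) / (1 - cmod (psi w) ^+ 2)) `^ beta.
  exact: powR_ge0.
by rewrite /kernel_ratio; lra.
Qed.

(** Both diagonal terms are kept, each at a cost of [e / 4], and the doubled cross term costs
    [e / 2]. *)
Lemma essnorm_sqr_ge2 (a b : R) : 0 <= a -> 0 <= b ->
  (forall e d, 0 < e -> 0 < d -> exists w, [/\ unit_disk R w, 1 - cmod w < d,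
     1 - cmod (phi w) ^+ 2 <= (a + e) * (1 - cmod w ^+ 2),
     1 - cmod (psi w) ^+ 2 <= (b + e) * (1 - cmod w ^+ 2) &
     1 - cmod w ^+ 2 <= e * cmod (1 - Num.conj (phi w) * psi w)]) ->
  ((1 / a `^ beta + 1 / b `^ beta)%:E <= E ^+ 2)%E.
Proof.
move=> a0 b0 hw; apply/lee_subgt0Pr => e e0; rewrite -EFinB.
have [d1 d10 h1] := powR_ratio_ge beta_gt0 a0 (e := e / 4) ltac:(by rewrite divr_gt0).
have [d3 d30 h3] := powR_ratio_ge beta_gt0 b0 (e := e / 4) ltac:(by rewrite divr_gt0).
have [d2 d20 h2] := powR_small beta_gt0 (e := e / 4) ltac:(by rewrite divr_gt0).
apply: essnorm_sqr_ge => d d0.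
have m0 : 0 < Num.min (Num.min d1 d2) d3 by rewrite !lt_min d10 d20.
have [w [Dw wd q1 q3 q2]] := hw _ d m0 d0; exists w; split=> //.
have p := one_sub_sqr_gt0 Dw.
have pp := one_sub_sqr_gt0 (Dphi Dw); have pq := one_sub_sqr_gt0 (Dpsi Dw).
have pc := one_sub_conjM_gt0 (Dphi Dw) (Dpsi Dw).
have r1 : 1 / a `^ beta - e / 4 <= ((1 - cmod w ^+ 2) / (1 - cmod (phi w) ^+ 2)) `^ beta.
  apply: h1 => //; apply: le_trans q1 _.
  by rewrite ler_pM2r // lerD2l !ge_min lexx.
have r3 : 1 / b `^ beta - e / 4 <= ((1 - cmod w ^+ 2) / (1 - cmod (psi w) ^+ 2)) `^ beta.
  apply: h3 => //; apply: le_trans q3 _.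
  by rewrite ler_pM2r // lerD2l !ge_min lexx !orbT.
have r2 : ((1 - cmod w ^+ 2) / cmod (1 - Num.conj (phi w) * psi w)) `^ beta <= e / 4.
  apply: h2; first by rewrite divr_ge0 ?ltW.
  rewrite ler_pdivrMr //; apply: le_trans q2 _.
  by rewrite ler_pM2r // !ge_min lexx orbT.
by rewrite /kernel_ratio; lra.
Qed.

End DbetaLowerBound.

(** * Finite Taylor expansions at a boundary point and their transfer to boundary values *)

Section Expansion.
Context {R : realType}.
Implicit Types (c : nat -> Cx R) (u v z x l zeta : Cx R) (phi psi : Cx R -> Cx R).

(** Coefficients are indexed by [nat], so that one sequence serves all truncation orders and can be
    shifted. *)
Definition jet c (k : nat) u : Cx R := \sum_(j < k.+1) c j * u ^+ j.

(** Induction through [u^(j+2) - v^(j+2) = u (u^(j+1) - v^(j+1)) + (u - v) v^(j+1)]. The factor [d]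
    in the Lipschitz constant makes the nonlinear terms of a jet negligible. *)
Lemma cmod_subX u v (d : R) n : d <= 1 -> cmod u <= d -> cmod v <= d ->
  cmod (u ^+ n.+2 - v ^+ n.+2) <= n.+2%:R * d * cmod (u - v).
Proof.
move=> d1 ud vd; have d0 : 0 <= d := le_trans (cmod_ge0 u) ud.
have vX j : cmod (v ^+ j.+1) <= d.
  rewrite cmodX exprS; apply: (le_trans _ vd); apply: ler_piMr (cmod_ge0 _) _.
  by apply: exprn_ile1 (cmod_ge0 _) (le_trans vd d1).
have step j C : cmod (u ^+ j.+1 - v ^+ j.+1) <= C * cmod (u - v) ->
    cmod (u ^+ j.+2 - v ^+ j.+2) <= (d * C + d) * cmod (u - v).
  move=> h; rewrite (_ : _ - _ = u * (u ^+ j.+1 - v ^+ j.+1) + (u - v) * v ^+ j.+1).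
    2: by rewrite !(exprS _ j.+1); ring.
  apply: le_trans (cmodD _ _) _; rewrite !cmodM mulrDl; apply: lerD.
    by rewrite -mulrA; apply: ler_pM; rewrite ?cmod_ge0.
  by rewrite mulrC ler_wpM2r ?cmod_ge0.
elim: n => [|n IH].
  have := @step 0%N 1; rewrite !expr1 mul1r => /(_ (lexx _)) /le_trans; apply.
  by rewrite mulr1 mulr_natl mulr2n.
apply: le_trans (step n.+1 _ IH) _; rewrite ler_wpM2r ?cmod_ge0 //.
rewrite -(natr1 n.+2) [leRHS]mulrDl mul1r lerD2r.
by apply: ler_piMl; rewrite // mulr_ge0.
Qed.

Lemma cmod_sum n (F : 'I_n -> Cx R) :
  cmod (\sum_(j < n) F j) <= \sum_(j < n) cmod (F j).
Proof.
elim: n F => [|n IH] F; first by rewrite !big_ord0 cmod0.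
rewrite !big_ord_recr /=; apply: le_trans (cmodD _ _) _.
by rewrite lerD2r IH.
Qed.

Lemma jet_lin c k (e : R) : 0 < e -> exists2 d : R, 0 < d & forall u v,
  cmod u <= d -> cmod v <= d ->
  cmod (jet c k.+1 u - jet c k.+1 v - c 1%N * (u - v)) <= e * cmod (u - v).
Proof.
move=> e0; pose C := \sum_(j < k) cmod (c j.+2) * j.+2%:R.
have C0 : 0 <= C by apply: sumr_ge0 => j _; rewrite mulr_ge0 ?cmod_ge0.
exists (Num.min 1 (e / (C + 1))).
  by rewrite lt_min ltr01 divr_gt0 //; lra.
move=> u v; set d := Num.min _ _ => ud vd.
have d1 : d <= 1 by rewrite ge_min lexx.
have dC : d * C <= e.
  have : d <= e / (C + 1) by rewrite ge_min lexx orbT.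
  rewrite ler_pdivlMr; last lra.
  have : 0 <= d := le_trans (cmod_ge0 u) ud; nra.
have -> : jet c k.+1 u - jet c k.+1 v - c 1%N * (u - v) =
    \sum_(j < k) c j.+2 * (u ^+ j.+2 - v ^+ j.+2).
  rewrite /jet !big_ord_recl /= !expr0 !expr1.
  under [RHS]eq_bigr => j _ do rewrite mulrBr.
  by rewrite sumrB; ring.
apply: (@le_trans _ _ (\sum_(j < k) cmod (c j.+2) * j.+2%:R * (d * cmod (u - v)))).
  apply: le_trans (cmod_sum _) _; apply: ler_sum => j _.
  rewrite cmodM -mulrA ler_wpM2l ?cmod_ge0 //.
  by rewrite mulrA; exact: cmod_subX.
by rewrite -mulr_suml -/C mulrA [C * d]mulrC ler_wpM2r ?cmod_ge0.
Qed.

Lemma jet0 c k : jet c k 0 = c 0%N.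
Proof.
rewrite /jet big_ord_recl expr0 mulr1 big1 ?addr0 // => j _.
by rewrite exprS mul0r mulr0.
Qed.

(** Induction on [j0]. A zero constant term lets [u] be factored out and the coefficients shifted;
    otherwise the bound for [j0] implies the one for [j0.+1] when [|u| < 1]. *)
Lemma jet_lower c k j0 : (j0 <= k)%N ->
  (exists2 j, (j <= j0)%N & c j != 0) -> exists kd : R * R,
  [/\ 0 < kd.1, 0 < kd.2 & forall u, cmod u < kd.2 ->
     kd.1 * cmod u ^+ j0 <= cmod (jet c k u)].
Proof.
elim: j0 c k => [|j0 IH] c k jk [j jj0 cj0].
- have {jj0 cj0 j}c0 : c 0%N != 0 by move: jj0 cj0; case: j.
  have c0p := cmod_gt0 c0.
  case: k jk => [|k] _.
    exists (cmod (c 0%N), 1); split=> //= u _.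
    by rewrite /jet big_ord_recl big_ord0 !expr0 !mulr1 addr0.
  have [d d0 hd] := jet_lin c k (e := 1) ltac:(by []).
  (* For [|u| < q] the linear term and the remainder [1 * |u|] together stay below [a], half of
     [|c 0|]. *)
  pose a := cmod (c 0%N) / 2; pose q := a / (cmod (c 1%N) + 1).
  have c1 := cmod_ge0 (c 1%N).
  have a0 : 0 < a by rewrite divr_gt0.
  exists (a, Num.min d q); split => //=.
    by rewrite lt_min d0 divr_gt0 //; lra.
  move=> u; rewrite lt_min => /andP[ud uq].
  have u0 := cmod_ge0 u.
  have := hd u 0 (ltW ud) ltac:(by rewrite cmod0 ltW).
  rewrite jet0 !subr0 => h.
  move: uq; rewrite ltr_pdivlMr ?expr0 ?mulr1; last lra.
  move=> uq.
  have t1 := cmod_lerB (c 0%N) (jet c k.+1 u).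
  have t2 : cmod (c 0%N - jet c k.+1 u) <=
      cmod (jet c k.+1 u - c 0%N - c 1%N * u) + cmod (c 1%N * u).
    rewrite cmodB; apply: le_trans (cmodD _ _); by rewrite subrK.
  rewrite cmodM in t2.
  have : a = cmod (c 0%N) / 2 by [].
  nra.
- case: k jk => // k jk.
  have [c00|c0] := eqVneq (c 0%N) 0.
    have [|[ka da] /= [k0 d0 h]] := IH (fun i => c i.+1) k jk.
      by case: j cj0 jj0 => [|j] cj0 jj0; [rewrite c00 eqxx in cj0|exists j].
    exists (ka, da); split => //= u /h {}h.
    have -> : jet c k.+1 u = u * jet (fun i => c i.+1) k u.
      rewrite /jet big_ord_recl /= c00 mul0r add0r mulr_sumr.
      by apply: eq_bigr => i _; rewrite exprS; ring.
    by rewrite cmodM exprS mulrCA ler_wpM2l ?cmod_ge0.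
  have [|[ka da] /= [k0 d0 h]] := IH c k.+1 (leqW jk); first by exists 0%N.
  exists (ka, Num.min 1 da); split => //=; first by rewrite lt_min ltr01.
  move=> u; rewrite lt_min => /andP[u1 /h]; apply: le_trans.
  rewrite ler_pM2l // exprS; apply: ler_piMl; last exact: ltW.
  by rewrite exprn_ge0 ?cmod_ge0.
Qed.

Definition expands phi zeta c k := forall e : R, 0 < e -> exists2 d : R, 0 < d &
  forall z, unit_disk R z -> cmod (z - zeta) < d ->
    cmod (phi z - jet c k (z - zeta)) <= e * cmod (z - zeta) ^+ k.

Lemma disk_sub_neq0 zeta z : cmod zeta = 1 -> unit_disk R z -> z - zeta != 0.
Proof.
move=> z1; rewrite /unit_disk /=; apply: contraTneq => /eqP.
by rewrite subr_eq0 => /eqP ->; rewrite z1 ltxx.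
Qed.

Lemma expandsP phi zeta c k : cmod zeta = 1 ->
  (phi z - jet c k (z - zeta)) / (z - zeta) ^+ k
    @[z --> within (unit_disk R) (nbhs zeta)] --> (0 : Cx R) <->
  expands phi zeta c k.
Proof.
move=> zeta1; rewrite cvg_within_cmodP; split=> h e e0.
- have [d d0 hd] := h e e0; exists d => // z Dz zd.
  have := hd z Dz zd; rewrite subr0 cmodM cmodV cmodX => /ltW.
  by rewrite ler_pdivrMr // exprn_gt0 // cmod_gt0 // disk_sub_neq0.
- have [d d0 hd] := h (e / 2) ltac:(by rewrite divr_gt0).
  exists d => // z Dz zd; have := hd z Dz zd.
  rewrite subr0 cmodM cmodV cmodX -ler_pdivrMr.
    by move=> /le_lt_trans; apply; lra.
  by rewrite exprn_gt0 // cmod_gt0 // disk_sub_neq0.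
Qed.

Lemma data_expands phi zeta k (b : 'I_k.+1 -> Cx R) c : cmod zeta = 1 ->
  (forall j : 'I_k.+1, b j = c j) ->
  data_coefficients phi zeta b <-> cmod (c 0%N) = 1 /\ expands phi zeta c k.
Proof.
move=> zeta1 bc; rewrite /data_coefficients bc /= -expandsP //.
by have -> : (fun z => (phi z - \sum_(j < k.+1) b j * (z - zeta) ^+ j)
    / (z - zeta) ^+ k) = (fun z => (phi z - jet c k (z - zeta)) / (z - zeta) ^+ k)
  by apply/funext => z; rewrite /jet; under eq_bigr do rewrite bc.
Qed.

Lemma expands_lin phi zeta c k : expands phi zeta c k.+1 ->
  forall e : R, 0 < e -> exists2 d : R, 0 < d &
  forall z, unit_disk R z -> cmod (z - zeta) < d ->
    cmod (phi z - c 0%N - c 1%N * (z - zeta)) <= e * cmod (z - zeta).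
Proof.
move=> he e e0; have e2 : 0 < e / 2 by rewrite divr_gt0.
have [d1 d10 h1] := he _ e2; have [d2 d20 h2] := jet_lin c k e2.
exists (Num.min (Num.min d1 d2) 1); first by rewrite !lt_min d10 d20 ltr01.
move=> z Dz; rewrite !lt_min => /andP[/andP[zd1 zd2] z1].
have := h2 (z - zeta) 0 (ltW zd2) ltac:(by rewrite cmod0 ltW).
rewrite jet0 !subr0 => q2; have q1 := h1 z Dz zd1.
have z0 := cmod_ge0 (z - zeta).
have q3 : cmod (z - zeta) ^+ k.+1 <= cmod (z - zeta).
  by rewrite exprS; apply: ler_piMr => //; apply: exprn_ile1 => //; exact: ltW.
rewrite (_ : _ - _ = (phi z - jet c k.+1 (z - zeta)) +
   (jet c k.+1 (z - zeta) - c 0%N - c 1%N * (z - zeta))); last by ring.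
apply: le_trans (cmodD _ _) _; nra.
Qed.

Lemma expandsW phi zeta c k : expands phi zeta c k.+1 -> expands phi zeta c k.
Proof.
move=> he e e0; have e2 : 0 < e / 2 by rewrite divr_gt0.
have [d1 d10 h1] := he _ e2; pose C := cmod (c k.+1).
have C0 : 0 <= C := cmod_ge0 _.
exists (Num.min (Num.min d1 (e / 2 / (C + 1))) 1).
  by rewrite !lt_min d10 ltr01 divr_gt0 //; lra.
move=> z Dz; rewrite !lt_min => /andP[/andP[zd1 zd2] z1].
have q1 := h1 z Dz zd1.
move: zd2; rewrite ltr_pdivlMr; last lra.
move=> zd2; move: q1; rewrite {1}/jet big_ord_recr /= -/(jet c k _) => q1.
rewrite (_ : _ - _ = (phi z - (jet c k (z - zeta) + c k.+1 * (z - zeta) ^+ k.+1))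
   + c k.+1 * (z - zeta) ^+ k.+1); last by ring.
apply: le_trans (cmodD _ _) _; rewrite cmodM cmodX -/C.
apply: le_trans (lerD q1 (lexx _)) _.
have z0 := cmod_ge0 (z - zeta).
rewrite exprS; have := exprn_ge0 k z0.
move: (cmod _ ^+ k) z0 zd2 z1 => a; move: (cmod _) => t; move=> t0 td t1 a0.
have : (e / 2 * t + C * t) * a <= e * a by apply: ler_wpM2r => //; nra.
lra.
Qed.

Lemma ofRB (x y : R) : ofR (x - y) = ofR x - ofR y.
Proof. by apply/eqP; rewrite eq_complex /= oppr0 addr0 !eqxx. Qed.

Lemma cmod_radial (r : R) x : cmod x = 1 -> 0 <= r -> cmod (ofR r * x) = r.
Proof. by move=> x1 r0; rewrite cmodM x1 mulr1 cmod_ofR ger0_norm. Qed.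

Lemma cmod_radialB (r : R) x : cmod x = 1 -> r <= 1 -> cmod (ofR r * x - x) = 1 - r.
Proof.
move=> x1 r1; rewrite -{2}[x]mul1r -mulrBl cmodM x1 mulr1.
by rewrite -[1]/(ofR 1) -ofRB cmod_ofR ler0_norm ?opprB // subr_le0.
Qed.

Lemma radial_disk (r : R) x : cmod x = 1 -> 0 <= r < 1 -> unit_disk R (ofR r * x).
Proof. by move=> x1 /andP[r0 r1]; rewrite /unit_disk /= cmod_radial. Qed.

(** The radius to [x] lies in the Stolz region of aperture 2, because
    [|r x - x| = 1 - r < 2 (1 - r)]. *)
Lemma nontangential_radial phi x l (e : R) : cmod x = 1 ->
  nontangential_limit phi x l -> 0 < e ->
  exists2 d : R, 0 < d & forall r, 0 <= r < 1 -> 1 - r < d ->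
    cmod (phi (ofR r * x) - l) < e.
Proof.
move=> x1 /(_ 2 ltac:(by rewrite ltr1n)) /cvg_within_cmodP h e0.
have [d d0 hd] := h e e0; exists d => // r /andP[r0 r1] rd.
apply: hd; last by rewrite cmod_radialB // ltW.
split; first by rewrite /unit_disk /= cmod_radial.
rewrite cmod_radialB ?ltW // cmod_radial //; lra.
Qed.

(** At a common point [(1 - s) x] of the radius, both [l] and [l'] are within a quarter of
    [|l - l'|] of the value of [phi]. *)
Lemma nontangential_unique phi x l l' : cmod x = 1 ->
  nontangential_limit phi x l ->
  (forall e : R, 0 < e -> exists2 d : R, 0 < d & forall z, unit_disk R z ->
     cmod (z - x) < d -> cmod (phi z - l') <= e) -> l = l'.
Proof.
move=> x1 hl hl'; apply/eqP; rewrite -subr_eq0; apply: contrapT => /negP ll.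
have lp := cmod_gt0 ll; pose e := cmod (l - l') / 4.
have e0 : 0 < e by rewrite divr_gt0.
have [d1 d10 h1] := nontangential_radial x1 hl e0.
have [d2 d20 h2] := hl' e e0.
pose s := Num.min (Num.min d1 d2) 1 / 2.
have s0 : 0 < s by rewrite divr_gt0 // !lt_min d10 d20 ltr01.
have [sd1 sd2 s1] : [/\ s < d1, s < d2 & s < 1].
  have m0 : 0 < Num.min (Num.min d1 d2) 1 by rewrite !lt_min d10 d20 ltr01.
  have sm : s < Num.min (Num.min d1 d2) 1 by rewrite /s; lra.
  by move: sm; rewrite !lt_min => /andP[/andP[]].
have r1 : 0 <= 1 - s < 1 by apply/andP; split; lra.
have q1 := h1 (1 - s) r1 ltac:(by rewrite subKr).
have := h2 (ofR (1 - s) * x).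
rewrite /unit_disk /= cmod_radial ?cmod_radialB //; try lra.
rewrite subKr => /(_ ltac:(lra) sd2) q2.
have : cmod (l - l') <= cmod (phi (ofR (1 - s) * x) - l) + cmod (phi (ofR (1 - s) * x) - l').
  rewrite [cmod (_ - l)]cmodB; apply: le_trans (cmodD _ _); by rewrite addrA subrK.
rewrite /e in q1 q2; lra.
Qed.

(** The expansion, known inside the disk, reaches [l] through [z = (1 - s) x]. Here [s] is so small
    that the nontangential error and the change of the jet from [z] to [x] each cost at most
    [e / 4 * D ^+ k.+1]; since [|z - zeta| <= 2 D], the factor [2 ^ k.+2] in [e'] leaves [e / 2] for
    the remainder at [z]. *)
Lemma boundary_expands phi zeta c k : cmod zeta = 1 -> expands phi zeta c k.+1 ->
  forall e : R, 0 < e -> exists2 d : R, 0 < d & forall x l,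
    cmod x = 1 -> 0 < cmod (x - zeta) < d -> nontangential_limit phi x l ->
    cmod (l - jet c k.+1 (x - zeta)) <= e * cmod (x - zeta) ^+ k.+1.
Proof.
move=> zeta1 he e e0; pose e' := e / 2 ^+ k.+2.
have e'0 : 0 < e' by rewrite divr_gt0 // exprn_gt0.
have [d1 d10 h1] := he e' e'0; have [d2 d20 h2] := jet_lin c k (e := 1) ltac:(by []).
exists (Num.min d1 d2 / 2); first by rewrite divr_gt0 // lt_min d10.
move=> x l x1 /andP[x0 xd] hl; set D := cmod (x - zeta) in x0 xd *.
have Dk : 0 < D ^+ k.+1 by rewrite exprn_gt0.
pose C := cmod (c 1%N) + 1; have C1 : 1 <= C by rewrite lerDr cmod_ge0.
pose t := e / 4 * D ^+ k.+1; have t0 : 0 < t by rewrite mulr_gt0 ?divr_gt0.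
have [d3 d30 h3] := nontangential_radial x1 hl t0.
pose s := Num.min (Num.min d3 D) (Num.min 1 (t / C)) / 2.
have m0 : 0 < Num.min (Num.min d3 D) (Num.min 1 (t / C)).
  by rewrite !lt_min d30 x0 ltr01 divr_gt0 //; lra.
have s0 : 0 < s by rewrite divr_gt0.
have [sd3 sD s1 st] : [/\ s < d3, s < D, s < 1 & s * C < t].
  have sm : s < Num.min (Num.min d3 D) (Num.min 1 (t / C)) by rewrite /s; lra.
  by move: sm; rewrite !lt_min => /andP[/andP[? ?] /andP[? h]]; split => //;
    move: h; rewrite ltr_pdivlMr //; lra.
have r1 : 0 <= 1 - s < 1 by apply/andP; split; lra.
have q3 := h3 (1 - s) r1 ltac:(by rewrite subKr).
set z := ofR (1 - s) * x in q3.
have Dz : unit_disk R z by rewrite /unit_disk /= cmod_radial //; lra.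
have zx : cmod (z - x) = s by rewrite cmod_radialB ?subKr //; lra.
have zz : cmod (z - zeta) <= 2 * D.
  have := cmodD (z - x) (x - zeta); rewrite zx addrA subrK -/D; lra.
have xd1 : 2 * D < d1 /\ 2 * D < d2.
  by move: xd; rewrite ltr_pdivlMr // lt_min mulrC => /andP[].
have q1 := h1 z Dz (le_lt_trans zz xd1.1).
have q2 := h2 (x - zeta) (z - zeta) ltac:(rewrite -/D; lra) ltac:(lra).
have xzB : (x - zeta) - (z - zeta) = - (z - x) by ring.
rewrite xzB cmodN zx mul1r in q2.
have q2' : cmod (jet c k.+1 (z - zeta) - jet c k.+1 (x - zeta)) <= C * s.
  rewrite cmodB (_ : _ - _ = (jet c k.+1 (x - zeta) - jet c k.+1 (z - zeta)
    - c 1%N * - (z - x)) + c 1%N * - (z - x)); last by ring.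
  apply: le_trans (cmodD _ _) _; rewrite cmodM cmodN zx /C; lra.
have q1' : e' * cmod (z - zeta) ^+ k.+1 <= e / 2 * D ^+ k.+1.
  apply: (@le_trans _ _ (e' * (2 * D) ^+ k.+1)).
    by rewrite ler_pM2l // lerXn2r ?nnegrE ?cmod_ge0 // mulr_ge0 // ltW.
  rewrite exprMn /e' (exprS 2 k.+1) le_eqVlt; apply/orP; left; apply/eqP.
  have : 2 ^+ k.+1 != 0 :> R by rewrite expf_neq0.
  by move: (2 ^+ k.+1) => y y0; field.
rewrite (_ : l - _ = - (phi z - l) + (phi z - jet c k.+1 (z - zeta)) +
  (jet c k.+1 (z - zeta) - jet c k.+1 (x - zeta))); last by ring.
apply: le_trans (cmodD _ _) _; apply: le_trans (lerD (cmodD _ _) (lexx _)) _.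
rewrite cmodN; rewrite /t in q3 st; lra.
Qed.

(** Both [phi (r x)] and [l] are close to the same jet, whose increment from [x] to [r x] is nearly
    [c 1 * (r x - x)], of modulus [|c 1| (1 - r)]. The second clause makes [|l - c 0|] comparable to
    [|x - zeta|] when [c 1] is nonzero. *)
Lemma radial_estimate phi zeta c k : cmod zeta = 1 -> expands phi zeta c k.+1 ->
  forall e : R, 0 < e -> exists2 d : R, 0 < d & forall x l (r : R),
    cmod x = 1 -> 0 < cmod (x - zeta) < d -> nontangential_limit phi x l ->
    0 <= r < 1 -> 1 - r <= cmod (x - zeta) ->
    cmod (phi (ofR r * x) - l) <=
      (cmod (c 1%N) + e) * (1 - r) + e * cmod (x - zeta) ^+ k.+1
    /\ cmod (l - c 0%N - c 1%N * (x - zeta)) <= e * cmod (x - zeta).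
Proof.
move=> zeta1 he e e0; pose e1 := e / 2; pose e2 := e / 2 ^+ k.+2.
have e10 : 0 < e1 by rewrite divr_gt0.
have e20 : 0 < e2 by rewrite divr_gt0 // exprn_gt0.
have [d1 d10 h1] := he e2 e20.
have [d2 d20 h2] := boundary_expands zeta1 he e10.
have [d3 d30 h3] := jet_lin c k e10.
pose d := Num.min (Num.min d1 d2) (Num.min d3 1).
have d0 : 0 < d by rewrite !lt_min d10 d20 d30 ltr01.
exists (d / 2); first by rewrite divr_gt0.
move=> x l r x1 /andP[x0 xd] hl r01 rD; set D := cmod (x - zeta) in x0 xd rD *.
have [r0 r1] : 0 <= r /\ r < 1 by move: r01 => /andP.
have : 2 * D < d by move: xd; rewrite ltr_pdivlMr // mulrC.
rewrite !lt_min => /andP[/andP[Dd1 Dd2] /andP[Dd3 D1]].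
set z := ofR r * x.
have Dz : unit_disk R z by rewrite /unit_disk /= cmod_radial.
have zx : cmod (z - x) = 1 - r by rewrite cmod_radialB // ltW.
have zz : cmod (z - zeta) <= 2 * D.
  have := cmodD (z - x) (x - zeta); rewrite zx addrA subrK -/D; lra.
have q1 := h1 z Dz (le_lt_trans zz Dd1).
have q2 := h2 x l x1 ltac:(by rewrite -/D x0; lra) hl.
rewrite -/D in q2.
have q3 := h3 (z - zeta) (x - zeta) ltac:(lra) ltac:(rewrite -/D; lra).
rewrite (_ : z - zeta - (x - zeta) = z - x) ?zx in q3; last by ring.
have q1' : e2 * cmod (z - zeta) ^+ k.+1 <= e / 2 * D ^+ k.+1.
  apply: (@le_trans _ _ (e2 * (2 * D) ^+ k.+1)).
    by rewrite ler_pM2l // lerXn2r ?nnegrE ?cmod_ge0 // mulr_ge0 // ltW.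
  rewrite exprMn /e2 (exprS 2 k.+1) le_eqVlt; apply/orP; left; apply/eqP.
  have : 2 ^+ k.+1 != 0 :> R by rewrite expf_neq0.
  by move: (2 ^+ k.+1) => y y0; field.
split.
- rewrite (_ : phi z - l = (phi z - jet c k.+1 (z - zeta)) +
    (jet c k.+1 (z - zeta) - jet c k.+1 (x - zeta) - c 1%N * (z - x)) +
    c 1%N * (z - x) - (l - jet c k.+1 (x - zeta))); last by ring.
  apply: le_trans (cmodD _ _) _; rewrite cmodN.
  apply: le_trans (lerD (cmodD _ _) (lexx _)) _.
  apply: le_trans (lerD (lerD (cmodD _ _) (lexx _)) (lexx _)) _.
  rewrite (cmodM (c 1%N)) zx; rewrite /e1 in q2 q3.
  have : 0 <= e * (1 - r) by apply: mulr_ge0; lra.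
  nra.
- have := h3 (x - zeta) 0 ltac:(rewrite -/D; lra) ltac:(by rewrite cmod0 ltW).
  rewrite jet0 !subr0 -/D => q4.
  rewrite (_ : _ - _ = (l - jet c k.+1 (x - zeta)) +
   (jet c k.+1 (x - zeta) - c 0%N - c 1%N * (x - zeta))); last by ring.
  apply: le_trans (cmodD _ _) _.
  have q5 : D ^+ k.+1 <= D.
    rewrite exprS; apply: ler_piMr; first exact: ltW.
    by apply: exprn_ile1; [exact: ltW|lra].
  rewrite /e1 in q2 q4; nra.
Qed.

End Expansion.

(** * Order of contact: growth of [1 - |phi|] near the boundary, and separation of two maps *)

Section Contact.
Context {R : realType}.
Implicit Types (c : nat -> Cx R) (x l zeta w : Cx R) (phi psi : Cx R -> Cx R).

Lemma expi_ex zeta : cmod zeta = 1 -> exists t, zeta = expi t.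
Proof.
move=> z1; have := cmod_sqr zeta; rewrite z1 expr1n.
case: zeta z1 => a b _ /= ab.
have a1 : -1 <= a <= 1.
  by rewrite -ler_norml -(@ler_pXn2r _ 2) ?nnegrE // expr1n real_normK ?num_real //
     {}ab lerDl sqr_ge0.
have sb : sin (acos a) = `|b|.
  rewrite sin_acos //; have -> : 1 - a ^+ 2 = b ^+ 2 by rewrite ab; ring.
  exact: sqrtr_sqr.
have [b0|b0] := leP 0 b.
- by exists (acos a); rewrite /expi acosK ?in_itv //= sb ger0_norm.
- by exists (- acos a); rewrite /expi cosN sinN acosK ?in_itv //= sb ltr0_norm ?opprK.
Qed.

(** Two null sets cannot cover the interval []t0, t0 + s[] of positive length. *)
Lemma ae_expi_near zeta (P Q : R -> Prop) : cmod zeta = 1 ->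
  {ae (@lebesgue_measure R), forall t, P t} ->
  {ae (@lebesgue_measure R), forall t, Q t} ->
  forall d : R, 0 < d -> exists t, [/\ P t, Q t & 0 < cmod (expi t - zeta) < d].
Proof.
move=> /expi_ex [t0 ->] hP hQ d d0.
have [h h0 hd] : exists2 h : R, 0 < h & forall t, `|t0 - t| < h ->
    cmod (expi t - expi t0) < d.
  have d2 : 0 < d / 2 by rewrite divr_gt0.
  have /cvgrPdist_lt /(_ _ d2) /nbhs_ballP [h1 /= h10 hc] := @continuous_cos R t0.
  have /cvgrPdist_lt /(_ _ d2) /nbhs_ballP [h2 /= h20 hs] := @continuous_sin R t0.
  exists (Num.min h1 h2); first by rewrite lt_min h10.
  move=> t; rewrite lt_min => /andP[/hc qc /hs qs].
  rewrite /= in qc qs.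
  have q : cmod (expi t - expi t0) <= `|cos t0 - cos t| + `|sin t0 - sin t|.
    rewrite cmodB (_ : _ - _ = ofR (cos t0 - cos t) + Complex 0 1 * ofR (sin t0 - sin t)).
      apply: le_trans (cmodD _ _) _; rewrite cmodM !cmod_ofR.
      have -> : cmod (Complex 0 1 : Cx R) = 1.
        by rewrite /cmod /= expr0n expr1n add0r sqrtr1.
      by rewrite mul1r.
    by apply/eqP; rewrite eq_complex /=; apply/andP; split; apply/eqP; ring.
  by apply: le_lt_trans q _; lra.
apply: contrapT => /forallNP hno.
case: hP => A [mA A0 PA]; case: hQ => A' [mA' A'0 QA'].
(* The bound [s <= 1] keeps [t - t0] below [pi], so that [sin (t - t0) > 0] and [expi t] differs
   from [zeta]. *)
pose s := Num.min h 1; have s0 : 0 < s by rewrite lt_min h0 ltr01.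
have sub : [set` `]t0, (t0 + s)[%R] `<=` A `|` A'.
  move=> t /=; rewrite in_itv /= => /andP[t1 t2]; apply: contrapT => /not_orP [nA nA'].
  have Pt : P t by apply: contrapT => nP; apply: nA; exact: PA.
  have Qt : Q t by apply: contrapT => nQ; apply: nA'; exact: QA'.
  have st : s <= h /\ s <= 1 by rewrite !ge_min !lexx orbT.
  apply: (hno t); split => //; apply/andP; split; last first.
    by apply: hd; rewrite ltr_distlC; apply/andP; split; lra.
  apply: cmod_gt0; rewrite subr_eq0; apply/eqP => -[ec es].
  have : 0 < sin (t - t0).
    apply: sin_gt0_pi; rewrite ?subr_gt0 //.
    have := @pi_ge2 R; lra.
  by rewrite sinB ec es mulrC subrr ltxx.
have : (lebesgue_measure [set` `]t0, (t0 + s)[%R] <= lebesgue_measure A + lebesgue_measure A')%E.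
  apply: le_trans _ (measureU2 _ mA mA').
  apply: le_measure; rewrite ?inE //; exact: measurableU.
rewrite [X in (_ <= X + _)%E -> _]A0 [X in (_ <= _ + X)%E -> _]A'0 adde0.
rewrite lebesgue_measure_itv /= lte_fin ltrDl s0.
rewrite -EFinB lee_fin; lra.
Qed.

Definition contact_at phi w (k : nat) (A B : R) x l :=
  [/\ nontangential_limit phi x l, cmod l <= 1 &
      A * cmod (w - l) ^+ k <= 1 - cmod l ^+ 2 <= B * cmod (w - l) ^+ k].

(** A quotient at least [A > 0] excludes [w = l], where division by zero would give 0; the
    denominator can then be multiplied out, and [1 - |l|^2 >= 0] follows. *)
Lemma contact_ratio phi w k (A B : R) x l : (0 < k)%N -> 0 < A ->
  nontangential_limit phi x l ->
  A <= (1 - cmod l ^+ 2) / (cmod (w - l) `^ k%:R) <= B ->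
  contact_at phi w k A B x l.
Proof.
move=> k0 A0 hl /andP[hA hB]; rewrite powR_mulrn ?cmod_ge0 // in hA hB.
have wl : 0 < cmod (w - l) ^+ k.
  rewrite lt_neqAle exprn_ge0 ?cmod_ge0 // andbT eq_sym; apply/eqP => e.
  by move: hA; rewrite e invr0 mulr0; lra.
rewrite ler_pdivlMr // in hA; rewrite ler_pdivrMr // in hB.
split=> //; last by rewrite hA hB.
rewrite -(@ler_pXn2r _ 2) ?nnegrE ?cmod_ge0 // expr1n.
have : 0 <= A * cmod (w - l) ^+ k by rewrite mulr_ge0 // ltW.
lra.
Qed.

(** Uniqueness of nontangential limits identifies the boundary value and the angular derivative with
    [c 0] and [c 1]. Writing the order as [k.+2] also fits the order [k.+1 = 2m - 1] of the compared
    data. *)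
Lemma sufficient_data_expands phi zeta m : cmod zeta = 1 ->
  sufficient_data phi zeta m -> exists c k (A B : R), [/\ (2 * m)%N = k.+2,
    cmod (c 0%N) = 1 /\ expands phi zeta c k.+2,
    angular_derivative phi zeta = c 1%N, 0 < A &
    exists2 d, 0 < d & {ae (@lebesgue_measure R), forall t : R,
      cmod (expi t - zeta) < d -> exists l,
      contact_at phi (c 0%N) k.+2 A B (expi t) l}].
Proof.
move=> zeta1 [m1 [d0 hd0] [_ [w [hw _ [A [B [d [A0 dp hae]]]]]]] [b hb]].
have [k kE] : exists k, (2 * m)%N = k.+2.
  by case: m m1 {hae b hb} => // m _; exists (2 * m)%N; rewrite mulnS.
move: hae b hb; rewrite kE => hae b hb.
pose c j := b (inord j).
have bc (j : 'I_k.+3) : b j = c j by rewrite /c inord_val.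
have [c01 hc] := (data_expands phi zeta1 bc).1 hb.
have lin := expands_lin hc.
have val0 e : 0 < e -> exists2 d : R, 0 < d & forall z, unit_disk R z ->
    cmod (z - zeta) < d -> cmod (phi z - c 0%N) <= e.
  move=> e0; have [d1 d10 h1] := lin 1 ltac:(by []).
  pose C := cmod (c 1%N) + 1; have C0 : 0 < C by rewrite ltr_wpDl ?cmod_ge0.
  exists (Num.min d1 (e / C)); first by rewrite lt_min d10 divr_gt0.
  move=> z Dz; rewrite lt_min ltr_pdivlMr // => /andP[/(h1 z Dz) q zC].
  have -> : phi z - c 0%N = (phi z - c 0%N - c 1%N * (z - zeta)) + c 1%N * (z - zeta).
    by ring.
  apply: le_trans (cmodD _ _) _; rewrite cmodM.
  rewrite /C in zC; lra.
have uw w' : nontangential_limit phi zeta w' -> w' = c 0%N.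
  by move=> h; exact: (nontangential_unique zeta1 h).
have ang d' : is_angular_derivative phi zeta d' -> d' = c 1%N.
  move=> [w' [_ /uw -> hd]]; apply: (nontangential_unique zeta1 hd) => e e0.
  have [d1 d10 h1] := lin e e0; exists d1 => // z Dz /(h1 z Dz) q.
  have z0 := disk_sub_neq0 zeta1 Dz.
  rewrite (_ : _ - _ = (phi z - c 0%N - c 1%N * (z - zeta)) / (z - zeta)).
    by rewrite cmodM cmodV ler_pdivrMr // cmod_gt0.
  by rewrite [RHS]mulrBl mulfK.
exists c, k, A, B; split => //.
  by rewrite /angular_derivative; case: xgetP => [y _ /ang //|/(_ d0)].
exists d => //; case: hae => N [mN N0 sN]; exists N; split => // t nt.
apply: sN => /= h; apply: nt => /h [l [hl hAB]].
by exists l; apply: contact_ratio => //; rewrite -(uw _ hw).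
Qed.

Lemma expands_same phi psi zeta c c' k : expands phi zeta c k ->
  expands psi zeta c k -> expands phi zeta c' k -> expands psi zeta c' k.
Proof.
move=> h1 h2 h3 e e0; have e3 : 0 < e / 3 by rewrite divr_gt0.
have [d1 d10 {}h1] := h1 _ e3; have [d2 d20 {}h2] := h2 _ e3.
have [d3 d30 {}h3] := h3 _ e3.
exists (Num.min (Num.min d1 d2) d3); first by rewrite !lt_min d10 d20.
move=> z Dz; rewrite !lt_min => /andP[/andP[/(h1 z Dz) q1 /(h2 z Dz) q2] /(h3 z Dz) q3].
rewrite (_ : _ - _ = (psi z - jet c k (z - zeta)) - (phi z - jet c k (z - zeta))
  + (phi z - jet c' k (z - zeta))); last by ring.
apply: le_trans (cmodD _ _) _; apply: le_trans (lerD (cmodD _ _) (lexx _)) _.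
rewrite cmodN; lra.
Qed.

Lemma eq_jet c c' k u : (forall j, (j <= k)%N -> c j = c' j) ->
  jet c k u = jet c' k u.
Proof. by move=> cc'; apply: eq_bigr => j _; rewrite cc' // -ltnS. Qed.

Lemma eq_expands phi zeta c c' k : (forall j, (j <= k)%N -> c j = c' j) ->
  expands phi zeta c k -> expands phi zeta c' k.
Proof.
move=> cc' h e /h [d d0 hd]; exists d => // z Dz zd.
by rewrite -(eq_jet _ cc'); exact: hd.
Qed.

(** The two sets of admissible coefficient families coincide, so [xget] selects the same element;
    uniqueness of Taylor coefficients does not enter. *)
Lemma boundary_data_eq phi psi zeta c c' k : cmod zeta = 1 ->
  expands phi zeta c k -> expands psi zeta c' k ->
  (forall j, (j <= k)%N -> c j = c' j) ->
  boundary_data phi zeta k = boundary_data psi zeta k.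
Proof.
move=> zeta1 h1 h2 cc'; have {}h1 := eq_expands cc' h1.
rewrite /boundary_data; suff -> : [set b : 'I_k.+1 -> Cx R | data_coefficients phi zeta b] =
    [set b | data_coefficients psi zeta b] by [].
apply/funext => b; apply/propext => /=.
have bE (j : 'I_k.+1) : b j = b (inord j) by rewrite inord_val.
rewrite !(data_expands _ zeta1 (c := fun j => b (inord j)) bE).
by split=> -[b1 h]; split=> //; [exact: (expands_same h1 h2)|exact: (expands_same h2 h1)].
Qed.

(** By contact [1 - |l|^2 <= B' D ^+ k.+1], and [1 - r >= M D ^+ k.+1] turns this into a small
    multiple of [1 - r]. What remains is [|phi (r x) - l|], nearly at most [|c 1| (1 - r)]. *)
Lemma contact_upper phi zeta c k (A B : R) : cmod zeta = 1 ->
  (forall z, unit_disk R z -> unit_disk R (phi z)) ->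
  expands phi zeta c k.+1 ->
  forall e : R, 0 < e -> exists M d : R, [/\ 0 < M, 0 < d & forall x l (r : R),
    cmod x = 1 -> 0 < cmod (x - zeta) < d -> contact_at phi (c 0%N) k.+1 A B x l ->
    0 <= r < 1 -> 1 - r <= cmod (x - zeta) ->
    M * cmod (x - zeta) ^+ k.+1 <= 1 - r ->
    1 - cmod (phi (ofR r * x)) ^+ 2 <= (cmod (c 1%N) + e) * (1 - r ^+ 2)].
Proof.
move=> zeta1 Dphi hc e e0.
pose C := cmod (c 1%N); have C0 : 0 <= C := cmod_ge0 _.
pose f := Num.min (e / 4) 1.
have f0 : 0 < f by rewrite lt_min divr_gt0 // ltr01.
have fe : f <= e / 4 by rewrite ge_min lexx.
have f1 : f <= 1 by rewrite ge_min lexx orbT.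
have [d1 d10 h1] := radial_estimate zeta1 hc f0.
pose B' := `|B| * (C + 1) ^+ k.+1.
have B'0 : 0 <= B' by rewrite mulr_ge0 ?normr_ge0 // exprn_ge0 //; lra.
(* The [+ 1] in [B' + 1] absorbs the error [f * D ^+ k.+1]. The bound [e / (C + e)] gives
   [2 C + e <= (C + e) (1 + r)], which passes from [1 - |phi|] and [1 - r] to squares. *)
exists ((B' + 1) / f), (Num.min d1 (e / (C + e))); split.
- by rewrite divr_gt0 //; lra.
- by rewrite lt_min d10 divr_gt0 //; lra.
move=> x l r x1 /andP[x0]; rewrite lt_min => /andP[xd1 xd2] [hl l1 /andP[_ lB]].
move=> r01 rD rM; have [r0 r1] : 0 <= r /\ r < 1 by move: r01 => /andP.
have [q1 q2] := h1 x l r x1 ltac:(by rewrite x0) hl r01 rD.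
have Dz : unit_disk R (ofR r * x) by rewrite /unit_disk /= cmod_radial.
have p1 : cmod (phi (ofR r * x)) < 1 := Dphi _ Dz.
have p0 := cmod_ge0 (phi (ofR r * x)).
have t1 := cmod_lerB l (phi (ofR r * x)).
have l0 := cmod_ge0 l.
rewrite cmodB in t1.
rewrite -/C in q1 *.
set D := cmod (x - zeta) in x0 xd1 xd2 rD rM q1 q2.
have q3 : cmod (c 0%N - l) <= (C + 1) * D.
  rewrite cmodB (_ : l - _ = (l - c 0%N - c 1%N * (x - zeta)) + c 1%N * (x - zeta)).
    apply: le_trans (cmodD _ _) _; rewrite cmodM -/D -/C; nra.
  by ring.
have q4 : 1 - cmod l ^+ 2 <= B' * D ^+ k.+1.
  apply: le_trans lB _; apply: (@le_trans _ _ (`|B| * cmod (c 0%N - l) ^+ k.+1)).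
    by rewrite ler_wpM2r ?exprn_ge0 ?cmod_ge0 // ler_norm.
  rewrite /B' -mulrA -exprMn ler_wpM2l ?normr_ge0 //.
  by rewrite lerXn2r ?nnegrE ?cmod_ge0 // mulr_ge0; lra.
have q5 : (B' + 1) * D ^+ k.+1 <= f * (1 - r).
  by move: rM; rewrite mulrAC ler_pdivrMr // [_ * f]mulrC.
have Dk : 0 <= D ^+ k.+1 by rewrite exprn_ge0 // ltW.
have q6 : 1 - cmod (phi (ofR r * x)) <= (C + e / 2) * (1 - r).
  have : cmod l ^+ 2 <= cmod l by rewrite expr2; nra.
  have : f * (1 - r) <= e / 4 * (1 - r) by rewrite ler_wpM2r //; lra.
  have : f * D ^+ k.+1 <= D ^+ k.+1 by rewrite -[leRHS]mul1r ler_wpM2r.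
  lra.
have q7 : (1 - r) * (C + e) <= e.
  by move: xd2; rewrite ltr_pdivlMr //; [nra|lra].
have q8 : (2 * C + e) * (1 - r) <= (C + e) * (1 + r) * (1 - r).
  by apply: ler_wpM2r; [lra|nra].
have -> : 1 - r ^+ 2 = (1 + r) * (1 - r) by ring.
rewrite expr2; nra.
Qed.

(** As [c 1] is nonzero, [|c 0 - l| >= C / 2 * D], so contact yields [1 - |l| >= A' D ^+ k.+1]. With
    [1 - r] small against [D ^+ k.+1], moving from [x] to [r x] loses at most half of it. *)
Lemma contact_lower phi zeta c k (A B : R) : cmod zeta = 1 -> 0 < A ->
  c 1%N != 0 -> expands phi zeta c k.+1 ->
  exists K d : R, [/\ 0 < K, 0 < d & forall x l (r : R),
    cmod x = 1 -> 0 < cmod (x - zeta) < d -> contact_at phi (c 0%N) k.+1 A B x l ->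
    0 <= r < 1 -> 1 - r <= cmod (x - zeta) ->
    1 - r <= K * cmod (x - zeta) ^+ k.+1 ->
    K * cmod (x - zeta) ^+ k.+1 <= 1 - cmod (phi (ofR r * x))].
Proof.
move=> zeta1 A0 c1 hc.
pose C := cmod (c 1%N); have C0 : 0 < C := cmod_gt0 c1.
pose A' := A * (C / 2) ^+ k.+1 / 2.
have A'0 : 0 < A' by rewrite divr_gt0 // mulr_gt0 // exprn_gt0 // divr_gt0.
pose f := Num.min (Num.min (A' / 4) (C / 2)) 1.
have f0 : 0 < f.
  by rewrite !lt_min ltr01 andbT; apply/andP; split; apply: divr_gt0.
have [fA fC f1] : [/\ f <= A' / 4, f <= C / 2 & f <= 1].
  by split; rewrite !ge_min lexx ?orbT.
have [d1 d10 h1] := radial_estimate zeta1 hc f0.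
exists (A' / 4 / (C + 1)), d1; split=> //; first by apply: divr_gt0; [exact: divr_gt0|lra].
move=> x l r x1 /andP[x0 xd1] [hl l1 /andP[lA _]] r01 rD rK.
have [r0 r1] : 0 <= r /\ r < 1 by move: r01 => /andP.
have [q1 q2] := h1 x l r x1 ltac:(by rewrite x0) hl r01 rD.
have t1 := cmod_lerB (phi (ofR r * x)) l.
have l0 := cmod_ge0 l.
set D := cmod (x - zeta) in x0 xd1 rD rK q1 q2 *; rewrite -/C in q1.
have Dk : 0 <= D ^+ k.+1 by rewrite exprn_ge0 // ltW.
have q3 : C / 2 * D <= cmod (c 0%N - l).
  have := cmod_lerB (c 1%N * (x - zeta)) (c 1%N * (x - zeta) - (l - c 0%N)).
  rewrite subKr [cmod (c 0%N - l)]cmodB cmodM -/D -/C.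
  rewrite [cmod (_ - (l - c 0%N))]cmodB; nra.
have q4 : 2 * A' * D ^+ k.+1 <= 1 - cmod l ^+ 2.
  apply: le_trans _ lA.
  have -> : 2 * A' * D ^+ k.+1 = A * (C / 2 * D) ^+ k.+1.
    by rewrite exprMn /A'; field.
  rewrite ler_pM2l // lerXn2r ?nnegrE ?cmod_ge0 //.
  by rewrite mulr_ge0 ?ltW // divr_gt0.
have q5 : A' * D ^+ k.+1 <= 1 - cmod l.
  have : 1 - cmod l ^+ 2 <= 2 * (1 - cmod l) by rewrite expr2; nra.
  lra.
have q6 : (1 - r) * (C + 1) <= A' / 4 * D ^+ k.+1.
  by move: rK; rewrite mulrAC ler_pdivlMr //; lra.
have q7 : A' / 4 / (C + 1) * D ^+ k.+1 <= A' / 4 * D ^+ k.+1.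
  apply: ler_wpM2r => //; rewrite ler_pdivrMr; last lra.
  by nra.
have q8 : f * D ^+ k.+1 <= A' / 4 * D ^+ k.+1 by apply: ler_wpM2r.
have q9 : f * (1 - r) <= 1 * (1 - r) by apply: ler_wpM2r => //; lra.
have q10 : 0 <= A' * D ^+ k.+1 by rewrite mulr_ge0 // ltW.
lra.
Qed.

(** [jet_lower] bounds the difference of the two jets below by [K |u|^k], and the two remainders of
    order [k.+1] take at most half of that. *)
Lemma expands_sub_lower phi psi zeta c c' k :
  expands phi zeta c k.+1 -> expands psi zeta c' k.+1 ->
  (exists2 j, (j <= k)%N & c j != c' j) ->
  exists K d : R, [/\ 0 < K, 0 < d & forall z, unit_disk R z ->
    cmod (z - zeta) < d -> K * cmod (z - zeta) ^+ k <= cmod (phi z - psi z)].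
Proof.
move=> h1 h2 [j jk cj].
have [|[K d] /= [K0 d0 h]] := @jet_lower R (fun i => c i - c' i) k.+1 k (leqnSn k).
  by exists j => //; rewrite subr_eq0.
have K4 : 0 < K / 4 by rewrite divr_gt0.
have [d1 d10 {}h1] := h1 _ K4; have [d2 d20 {}h2] := h2 _ K4.
exists (K / 2), (Num.min (Num.min d 1) (Num.min d1 d2)); split.
- by rewrite divr_gt0.
- by rewrite !lt_min d0 ltr01 d10.
move=> z Dz; rewrite !lt_min => /andP[/andP[/h q z1] /andP[/(h1 z Dz) q1 /(h2 z Dz) q2]].
set u := z - zeta in z1 q q1 q2 *.
have u0 := cmod_ge0 u.
have jB : jet (fun i => c i - c' i) k.+1 u = jet c k.+1 u - jet c' k.+1 u.
  by rewrite /jet -sumrB; apply: eq_bigr => i _; rewrite mulrBl.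
have uk : cmod u ^+ k.+1 <= cmod u ^+ k.
  by rewrite exprS; apply: ler_piMl; [rewrite exprn_ge0|exact: ltW].
have t : cmod (jet c k.+1 u - jet c' k.+1 u) <= cmod (phi z - psi z) +
    cmod (phi z - jet c k.+1 u) + cmod (psi z - jet c' k.+1 u).
  rewrite (_ : _ - _ = (phi z - psi z) - (phi z - jet c k.+1 u)
    + (psi z - jet c' k.+1 u)); last by ring.
  apply: le_trans (cmodD _ _) _; apply: le_trans (lerD (cmodD _ _) (lexx _)) _.
  by rewrite cmodN.
rewrite jB in q.
have : K / 4 * cmod u ^+ k.+1 <= K / 4 * cmod u ^+ k by rewrite ler_pM2l.
lra.
Qed.

End Contact.

(** * Lower bounds for the denominator of the cross term *)

Section CrossTerm.
Context {R : realType}.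
Implicit Types z w : Cx R.

Lemma one_sub_conjM_gel z w : cmod z <= 1 -> cmod w <= 1 ->
  1 - cmod z <= cmod (1 - Num.conj z * w).
Proof.
move=> z1 w1; apply: le_trans _ (cmod_lerB _ _).
rewrite cmod1 cmodM cmod_conj lerD2l lerN2.
by apply: ler_piMr; rewrite ?cmod_ge0.
Qed.

Lemma one_sub_conjM_ger z w : cmod z <= 1 -> cmod w <= 1 ->
  1 - cmod w <= cmod (1 - Num.conj z * w).
Proof.
move=> z1 w1; apply: le_trans _ (cmod_lerB _ _).
rewrite cmod1 cmodM cmod_conj lerD2l lerN2.
by apply: ler_piMl; rewrite ?cmod_ge0.
Qed.

(** From [z (1 - conj z * w) = (z - w) + (1 - |z|^2) w]. It serves when [z] and [w] are farther
    apart than [1 - |z|^2]. *)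
Lemma one_sub_conjM_ge_sub z w : cmod z <= 1 -> cmod w <= 1 ->
  cmod (z - w) - (1 - cmod z ^+ 2) <= cmod (1 - Num.conj z * w).
Proof.
move=> z1 w1; have z0 := cmod_ge0 z; have w0 := cmod_ge0 w.
have t0 : 0 <= 1 - cmod z ^+ 2 by rewrite subr_ge0 exprn_ile1.
apply: (@le_trans _ _ (cmod (z * (1 - Num.conj z * w)))); last first.
  by rewrite cmodM; apply: ler_piMl => //; exact: cmod_ge0.
have -> : z * (1 - Num.conj z * w) = (z - w) - - (ofR (1 - cmod z ^+ 2) * w).
  by rewrite ofRB -mul_conj -[ofR 1]/(1 : Cx R); ring.
apply: le_trans _ (cmod_lerB _ _); rewrite cmodN cmodM cmod_ofR ger0_norm //.
by rewrite lerD2l lerN2; apply: ler_piMr.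
Qed.

Lemma cmod_conjM1 z w : cmod z = 1 -> cmod (Num.conj z * w) = cmod w.
Proof. by move=> z1; rewrite cmodM cmod_conj z1 mul1r. Qed.

Lemma cmod_sqr_one_sub (s : R) z :
  cmod (1 - ofR s * z) ^+ 2 = 1 - 2 * s * complex.Re z + s ^+ 2 * cmod z ^+ 2.
Proof. by rewrite !cmod_sqr; case: z => a b /=; ring. Qed.

End CrossTerm.

(** * The case [psi'(zeta) = 0] with [phi'(zeta)] nonzero *)

Section VanishingDerivative.
Context {R : realType} (beta : R) (beta_gt0 : 0 < beta) (H : Dbeta beta).
Context (phi psi : Cx R -> Cx R)
  (Dphi : forall z, unit_disk R z -> unit_disk R (phi z))
  (Dpsi : forall z, unit_disk R z -> unit_disk R (psi z)).

(** Were the real part negative, the first order expansion along the radius to [zeta] would carry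
    [phi] out of the disk. *)
Lemma angular_Re_ge0 (zeta : Cx R) c k : cmod zeta = 1 -> cmod (c 0%N) = 1 ->
  expands phi zeta c k.+1 -> 0 <= complex.Re (Num.conj (c 0%N) * c 1%N * zeta).
Proof.
move=> zeta1 c01 hc; set g := _ * zeta; rewrite leNgt; apply/negP => g0.
have [d d0 hd] := expands_lin hc (e := - complex.Re g / 2) ltac:(lra).
pose s := Num.min d 1 / 2.
have m0 : 0 < Num.min d 1 by rewrite lt_min d0 ltr01.
have s0 : 0 < s by rewrite divr_gt0.
have [sd s1] : s < d /\ s < 1.
  have : s < Num.min d 1 by rewrite /s; lra.
  by rewrite lt_min => /andP[].
pose z := ofR (1 - s) * zeta.
have Dz : unit_disk R z by rewrite /unit_disk /= cmod_radial //; lra.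
have zz : cmod (z - zeta) = s by rewrite cmod_radialB ?subKr //; lra.
have := hd z Dz ltac:(by rewrite zz); rewrite zz => q.
have p : cmod (phi z) < 1 := Dphi Dz.
have zE : z - zeta = - (ofR s * zeta).
  by rewrite /z ofRB -[ofR 1]/(1 : Cx R); ring.
have lo : 1 - s * complex.Re g <= cmod (c 0%N + c 1%N * (z - zeta)).
  rewrite -(cmod_conjM1 _ c01).
  apply: le_trans _ (Re_le_cmod _).
  have -> : Num.conj (c 0%N) * (c 0%N + c 1%N * (z - zeta)) = 1 - ofR s * g.
    by rewrite mulrDr [_ * c 0%N]mulrC mul_conj c01 expr1n zE /g -[ofR 1]/(1 : Cx R); ring.
  by rewrite ReD ReN Re_ofRM.
have := cmod_lerB (c 0%N + c 1%N * (z - zeta)) (phi z).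
rewrite cmodB opprD addrA => t; nra.
Qed.

(* Along [zeta (1 - s u)] with [Re u > 0] the kernel at [psi] outgrows [k_w],
   while the one at [phi] stays comparable to it, provided
   [Re (conj (phi zeta) phi'(zeta) zeta u) > 0]. *)
Lemma essnorm_sqr_infinite (zeta : Cx R) c k c' k' : cmod zeta = 1 ->
  cmod (c 0%N) = 1 -> expands phi zeta c k.+1 -> c 1%N != 0 ->
  cmod (c' 0%N) = 1 -> expands psi zeta c' k'.+1 -> c' 1%N = 0 ->
  forall L : R, (L%:E <=
    essnorm H (fun f => comp_operator phi f - comp_operator psi f)%R ^+ 2)%E.
Proof.
move=> zeta1 c01 hc c1 c'01 hc' c'1 L.
have Re_g := angular_Re_ge0 zeta1 c01 hc.
pose g := Num.conj (c 0%N) * c 1%N * zeta; rewrite -/g in Re_g.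
have g0 : g != 0.
  rewrite -normr_eq0 normE /g !cmodM cmod_conj c01 zeta1 mul1r mulr1.
  by rewrite -normE normr_eq0.
(* This [u] gives [Re (g u) = Re g + (Im g)^2], positive because [Re g >= 0] and [g] is nonzero. *)
pose u : Cx R := Complex 1 (- complex.Im g).
pose U := cmod u.
have U1 : 1 <= U by have := Re_le_cmod u.
pose rho := complex.Re (g * u).
have rhoE : rho = complex.Re g + complex.Im g ^+ 2.
  by rewrite /rho /u; case: (g) => a b /=; ring.
have rho0 : 0 < rho.
  have y0 := sqr_ge0 (complex.Im g).
  rewrite rhoE lt_neqAle addr_ge0 // andbT eq_sym paddr_eq0 // sqrf_eq0.
  apply: contra g0 => /andP[/eqP a0 /eqP b0].
  by apply/eqP; move: a0 b0; case: (g) => a b /= -> ->.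
pose G := cmod (g * u) ^+ 2.
have G0 : 0 <= G by rewrite exprn_ge0 ?cmod_ge0.
(* The [psi] term will be at least [T] and the cross term at most [2 (8 / rho)^beta], which leaves
   more than [L]. *)
pose T := `|L| + 2 * (8 / rho) `^ beta + 1.
have T0 : 0 < T.
  have := powR_ge0 (8 / rho) beta; have := normr_ge0 L; rewrite /T; lra.
pose La := T `^ beta^-1.
have La0 : 0 < La by rewrite powR_gt0.
have LaT : La `^ beta = T by rewrite -powRrM mulVf ?gt_eqF // powRr1 // ltW.
have e1 : 0 < rho / 4 / U by rewrite !divr_gt0 //; lra.
have [d1 d10 h1] := expands_lin hc e1.
pose f := (2 * U * La)^-1.
have f0 : 0 < f by rewrite invr_gt0 !mulr_gt0 //; lra.
have [d2 d20 h2] := expands_lin hc' f0.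
apply: (essnorm_sqr_ge beta_gt0 H Dphi Dpsi) => d d0.
(* Since [|z - zeta| = s U], the bounds with [d1], [d2] keep [z] where the expansions hold. The one
   with [G] controls the term [s^2 G], [2 / rho] keeps [1 - s rho / 2] nonnegative, and [U^-2] gives
   [1 - |z|^2 >= s]. *)
pose m := Num.min (Num.min (Num.min (d1 / U) (d2 / U)) (Num.min (d / 2) 1))
  (Num.min (Num.min (rho / (G + 1)) (2 / rho)) (U ^+ 2)^-1).
have m0 : 0 < m.
  have U0 : 0 < U by lra.
  have G1 : 0 < G + 1 by lra.
  rewrite !lt_min; do ?[apply/andP; split];
    by [exact: divr_gt0|exact: ltr01|rewrite invr_gt0 exprn_gt0].
pose s := m / 2; have s0 : 0 < s by rewrite divr_gt0.
have : s < m by rewrite /s; lra.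
rewrite !lt_min !ltr_pdivlMr; try lra.
move=> /andP[/andP[/andP[sd1 sd2] /andP[sd s1]] /andP[/andP[sG srho] sU]].
have {}sU : s * U ^+ 2 < 1.
  by move: sU; rewrite -[ltRHS]mul1r ltr_pdivlMr // exprn_gt0 //; lra.
pose z := zeta * (1 - ofR s * u).
have zz2 : cmod z ^+ 2 = 1 - 2 * s + s ^+ 2 * U ^+ 2.
  by rewrite /z cmodM zeta1 mul1r cmod_sqr_one_sub /= mulr1.
have z0 := cmod_ge0 z.
have zlo : s <= 1 - cmod z ^+ 2 by rewrite zz2; nra.
have zhi : 1 - cmod z ^+ 2 <= 2 * s.
  by rewrite zz2; have := mulr_ge0 (sqr_ge0 s) (sqr_ge0 U); lra.
have zlt1 : cmod z < 1.
  by rewrite -(@ltr_pXn2r _ 2) ?nnegrE // expr1n; lra.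
have Dz : unit_disk R z by [].
have zd : cmod (z - zeta) = s * U.
  rewrite (_ : z - zeta = - (ofR s * u * zeta)); last by rewrite /z; ring.
  by rewrite cmodN !cmodM zeta1 mulr1 cmod_ofR gtr0_norm.
exists z; split => //.
  have : cmod z ^+ 2 <= cmod z by rewrite expr2; apply: ler_piMr => //; exact: ltW.
  lra.
have := h1 z Dz ltac:(by rewrite zd); have := h2 z Dz ltac:(by rewrite zd).
rewrite c'1 mul0r subr0 zd => q2 q1.
have p1 : cmod (phi z) < 1 := Dphi Dz.
have p2 : cmod (psi z) < 1 := Dpsi Dz.
have lin : cmod (c 0%N + c 1%N * (z - zeta)) <= 1 - s * rho / 2.
  rewrite -(cmod_conjM1 _ c01).
  have -> : Num.conj (c 0%N) * (c 0%N + c 1%N * (z - zeta)) = 1 - ofR s * (g * u).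
    rewrite mulrDr [_ * c 0%N]mulrC mul_conj c01 expr1n /g /z.
    by rewrite -[ofR 1]/(1 : Cx R); ring.
  rewrite -(@ler_pXn2r _ 2) ?nnegrE ?cmod_ge0 //; last lra.
  rewrite cmod_sqr_one_sub -/rho -/G.
  have : s * (s * (G + 1)) <= s * rho by rewrite ler_pM2l // ltW.
  nra.
have q1' : rho / 4 / U * (s * U) = rho * s / 4 by field; lra.
have phi_lo : s * rho / 4 <= 1 - cmod (phi z).
  have := cmod_lerB (phi z) (c 0%N + c 1%N * (z - zeta)).
  rewrite opprD addrA => t; lra.
have cross : s * rho / 4 <= cmod (1 - Num.conj (phi z) * psi z).
  apply: le_trans phi_lo _; apply: one_sub_conjM_gel; exact: ltW.
have psi_hi : La * (1 - cmod (psi z) ^+ 2) <= 1 - cmod z ^+ 2.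
  have t := cmod_lerB (c' 0%N) (psi z); rewrite c'01 cmodB in t.
  have fs : f * (s * U) * (2 * La) = s by rewrite /f; field; rewrite !gt_eqF //; lra.
  have : La * (1 - cmod (psi z) ^+ 2) <= La * (2 * (f * (s * U))).
    rewrite ler_pM2l //; have := cmod_ge0 (psi z); rewrite expr2; nra.
  lra.
have r1 : 0 <= ((1 - cmod z ^+ 2) / (1 - cmod (phi z) ^+ 2)) `^ beta by exact: powR_ge0.
have r2 : T <= ((1 - cmod z ^+ 2) / (1 - cmod (psi z) ^+ 2)) `^ beta.
  rewrite -LaT; apply: powR_le => //; first exact: ltW.
  by rewrite ler_pdivlMr // one_sub_sqr_gt0 // Dpsi.
have r3 : ((1 - cmod z ^+ 2) / cmod (1 - Num.conj (phi z) * psi z)) `^ beta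
    <= (8 / rho) `^ beta.
  have cp := one_sub_conjM_gt0 (Dphi Dz) (Dpsi Dz).
  apply: powR_le => //; first by apply: divr_ge0; [lra|exact: ltW].
  rewrite ler_pdivrMr //.
  have E8 : 8 / rho * (s * rho / 4) = 2 * s by field; rewrite gt_eqF.
  apply: le_trans zhi _; rewrite -E8 ler_pM2l // divr_gt0 //.
rewrite /kernel_ratio; have := ler_norm L; rewrite /T in r2; lra.
Qed.

End VanishingDerivative.

(** * Choice of the points approaching [zeta] for unequal and for equal orders of contact *)

Theorem corollary5p8 (R : realType) (beta : R) (hbeta : 1 <= beta)
    (H : Dbeta beta) (zeta : Cx R) (hzeta : cmod zeta = 1)
    (phi psi : Cx R -> Cx R)
    (hphi : analytic_self_map phi) (hpsi : analytic_self_map psi)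
    (m n : nat) (dphi : sufficient_data phi zeta m)
    (dpsi : sufficient_data psi zeta n) :
  let E := essnorm H (fun f => comp_operator phi f - comp_operator psi f) in
  ((n < m)%N ->
    ((1 / cmod (angular_derivative phi zeta) `^ beta)%:E <= E ^+ 2)%E)
  /\
  (n = m ->
    boundary_data phi zeta (2 * m).-1%N <> boundary_data psi zeta (2 * m).-1%N ->
    ((1 / cmod (angular_derivative phi zeta) `^ beta
      + 1 / cmod (angular_derivative psi zeta) `^ beta)%:E <= E ^+ 2)%E).
Proof.
have beta_gt0 : 0 < beta := lt_le_trans ltr01 hbeta.
have Dphi := hphi.2; have Dpsi := hpsi.2.
have [c [k [A [B [kE [c01 hc] -> A0 [d0 d00 aephi]]]]]] :=
  sufficient_data_expands hzeta dphi.
have [c' [k' [A' [B' [k'E [c'01 hc'] -> A'0 [d0' d00' aepsi]]]]]] :=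
  sufficient_data_expands hzeta dpsi.
have near := ae_expi_near hzeta aephi aepsi.
move=> E; split=> [nm|nm].
- have [c10|c1] := eqVneq (c 1%N) 0.
    rewrite c10 cmod0 powR0 ?gt_eqF // invr0 mulr0; exact: sqre_ge0.
  have [c'10|c'1] := eqVneq (c' 1%N) 0.
    exact: (essnorm_sqr_infinite beta_gt0 H Dphi Dpsi hzeta c01 hc c1 c'01 hc' c'10).
  (* The orders of contact are [2m = k.+2] and [2n = k'.+2]; the strict inequality supplies the
     extra factor [D] in [Dk]. *)
  have k'k : (k'.+3 <= k.+2)%N.
    by rewrite -kE -k'E ltn_pmul2l.
  apply: (essnorm_sqr_ge1 beta_gt0 H Dphi Dpsi); first exact: cmod_ge0.
  move=> e d e0 dp.
  have [M [d1 [M0 d10 h1]]] := contact_upper A B hzeta Dphi hc e0.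
  have [K [d2 [K0 d20 h2]]] := contact_lower B' hzeta A'0 c'1 hc'.
  (* With [1 - r = M D ^+ k.+2], the bound [1 / M] gives [1 - r <= D], [K / M] gives the smallness
     required by [contact_lower], and the last one makes [1 - r ^+ 2] at most [e] times the
     denominator of the cross term. *)
  pose mn := Num.min (Num.min (Num.min d0 d0') (Num.min d1 d2))
    (Num.min (Num.min d 1) (Num.min (1 / M) (Num.min (K / M) (e * K / (2 * M))))).
  have mn0 : 0 < mn.
    by rewrite !lt_min d00 d00' d10 d20 dp ltr01 !divr_gt0 // mulr_gt0.
  have [t [P Q /andP[t0 tm]]] := near _ mn0.
  move: tm; rewrite !lt_min !ltr_pdivlMr ?mulr_gt0 //.
  move=> /andP[/andP[/andP[/P [l hl] /Q [l' hl']] /andP[td1 td2]]].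
  move=> /andP[/andP[td t1] /andP[tM /andP[tK te]]].
  have x1 := cmod_expi t.
  set x := expi t in t0 hl hl' td1 td2 td t1 tM tK te x1.
  set D := cmod (x - zeta) in t0 td1 td2 td t1 tM tK te.
  have Dk : D ^+ k.+2 <= D * D ^+ k'.+2.
    by rewrite -exprS; apply: ler_wiXn2l => //; exact: ltW.
  have Dk' : 0 < D ^+ k'.+2 by rewrite exprn_gt0.
  have Dk'D : D ^+ k'.+2 <= 1 by apply: exprn_ile1; exact: ltW.
  pose r := 1 - M * D ^+ k.+2.
  have rE : 1 - r = M * D ^+ k.+2 by rewrite subKr.
  have rM : 1 - r <= D * M * D ^+ k'.+2.
    by rewrite rE [D * M]mulrC -[leRHS]mulrA ler_pM2l.
  have rD : 1 - r <= D.
    rewrite rE; apply: (@le_trans _ _ (M * D * D)).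
      rewrite -mulrA ler_pM2l // !exprS mulrA; apply: ler_piMr.
        by apply: mulr_ge0; exact: ltW.
      by apply: exprn_ile1; exact: ltW.
    by rewrite [M * D]mulrC; apply: ler_piMl; exact: ltW.
  have r01 : 0 <= r < 1.
    have : 0 < M * D ^+ k.+2 by rewrite mulr_gt0 // exprn_gt0.
    by rewrite -rE => ?; apply/andP; split; lra.
  have [r0 r1] : 0 <= r /\ r < 1 by move: r01 => /andP.
  have Dz : unit_disk R (ofR r * x) by exact: radial_disk.
  have q1 := h1 x l r x1 ltac:(by rewrite t0) hl r01 rD ltac:(by rewrite rE).
  have rK : 1 - r <= K * D ^+ k'.+2.
    by apply: le_trans rM _; apply: ler_wpM2r; exact: ltW.
  have q2 := h2 x l' r x1 ltac:(by rewrite t0) hl' r01 rD rK.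
  exists (ofR r * x); rewrite cmod_radial //; split => //; first lra.
  have q3 : K * D ^+ k'.+2 <= cmod (1 - Num.conj (phi (ofR r * x)) * psi (ofR r * x)).
    apply: le_trans q2 _; apply: one_sub_conjM_ger; apply: ltW.
      exact: Dphi.
    exact: Dpsi.
  apply: le_trans _ (ler_wpM2l (ltW e0) q3).
  have : 2 * (D * M * D ^+ k'.+2) <= e * (K * D ^+ k'.+2).
    have -> : 2 * (D * M * D ^+ k'.+2) = (D * (2 * M)) * D ^+ k'.+2 by ring.
    by rewrite [e * _]mulrA; apply: ler_wpM2r; exact: ltW.
  have : 1 - r ^+ 2 <= 2 * (1 - r) by rewrite expr2; nra.
  lra.
- subst n; have kk : k' = k by move: k'E; rewrite kE => -[].
  subst k'; rewrite kE /= => bd.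
  (* By contraposition of [boundary_data_eq] at order [k.+1 = 2m - 1]. *)
  have [j jk cj] : exists2 j, (j <= k.+1)%N & c j != c' j.
    apply: contrapT => /forall2NP hj; apply: bd.
    apply: (boundary_data_eq hzeta (expandsW hc) (expandsW hc')) => j jk.
    by have [//|/negP] := hj j; rewrite negbK => /eqP.
  apply: (essnorm_sqr_ge2 beta_gt0 H Dphi Dpsi); rewrite ?cmod_ge0 //.
  move=> e d e0 dp.
  have [M1 [d1 [M10 d10 h1]]] := contact_upper A B hzeta Dphi hc e0.
  have [M2 [d2 [M20 d20 h2]]] := contact_upper A' B' hzeta Dpsi hc' e0.
  have [K' [d3 [K'0 d30 h3]]] := expands_sub_lower hc hc' (ex_intro2 _ _ j jk cj).
  (* The sum lets one radius satisfy the upper estimates for both maps. *)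
  pose M := M1 + M2; have M0 : 0 < M by rewrite addr_gt0.
  (* The power of 2 pays for [|z - zeta| >= D / 2] in [q3]. *)
  have [K K0 KE] : exists2 K : R, 0 < K & K = K' / 2 ^+ k.+1.
    by exists (K' / 2 ^+ k.+1) => //; rewrite divr_gt0 // exprn_gt0.
  pose C := cmod (c 1%N) + e.
  have C0 : 0 < C by rewrite ltr_wpDl ?cmod_ge0.
  (* The bound [1 / (2 * M)] gives [1 - r <= D / 2], the one with [C] gives [q6], and the last one
     makes [1 - r ^+ 2] at most [e * K / 2 * D ^+ k.+1]. *)
  pose mn := Num.min (Num.min (Num.min d0 d0') (Num.min d1 d2))
    (Num.min (Num.min (Num.min d 1) (d3 / 2)) (Num.min (1 / (2 * M))
      (Num.min (K / (4 * C * M)) (e * K / (4 * M))))).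
  have mn0 : 0 < mn.
    by rewrite !lt_min d00 d00' d10 d20 dp ltr01 !divr_gt0 ?mulr_gt0.
  have [t [P Q /andP[t0 tm]]] := near _ mn0.
  move: tm; rewrite !lt_min !ltr_pdivlMr ?mulr_gt0 //.
  move=> /andP[/andP[/andP[/P [l hl] /Q [l' hl']] /andP[td1 td2]]].
  move=> /andP[/andP[/andP[td t1] td3] /andP[tM /andP[tC te]]].
  have x1 := cmod_expi t.
  set x := expi t in t0 hl hl' td1 td2 td t1 td3 tM tC te x1.
  set D := cmod (x - zeta) in t0 td1 td2 td t1 td3 tM tC te.
  have Dk : 0 < D ^+ k.+1 by rewrite exprn_gt0.
  have Dk1 : D ^+ k <= 1 by apply: exprn_ile1; exact: ltW.
  pose r := 1 - M * D ^+ k.+2.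
  have rE : 1 - r = D * M * D ^+ k.+1 by rewrite subKr (exprS D k.+1); ring.
  have rD : 1 - r <= D / 2.
    rewrite rE exprS.
    have : D * M * (D * D ^+ k) <= D * M * D.
      by rewrite ler_pM2l ?mulr_gt0 //; apply: ler_piMr => //; exact: ltW.
    have : D * (D * (2 * M)) <= D * 1 by rewrite ler_pM2l // ltW.
    lra.
  have r01 : 0 <= r < 1.
    have : 0 < D * M * D ^+ k.+1 by rewrite !mulr_gt0.
    by rewrite -rE => ?; apply/andP; split; lra.
  have [r0 r1] : 0 <= r /\ r < 1 by move: r01 => /andP.
  have rD' : 1 - r <= D by lra.
  have Dz : unit_disk R (ofR r * x) by exact: radial_disk.
  have rM1 : M1 * D ^+ k.+2 <= 1 - r.
    by rewrite subKr; apply: ler_wpM2r; [rewrite exprn_ge0 ?ltW|rewrite lerDl ltW].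
  have rM2 : M2 * D ^+ k.+2 <= 1 - r.
    by rewrite subKr; apply: ler_wpM2r; [rewrite exprn_ge0 ?ltW|rewrite lerDr ltW].
  have q1 := h1 x l r x1 ltac:(by rewrite t0) hl r01 rD' rM1.
  have q2 := h2 x l' r x1 ltac:(by rewrite t0) hl' r01 rD' rM2.
  exists (ofR r * x); rewrite cmod_radial //; split => //; first lra.
  set z := ofR r * x in Dz q1 q2 *.
  have zx : cmod (z - x) = 1 - r by rewrite cmod_radialB // ltW.
  have zlo : D / 2 <= cmod (z - zeta).
    have := cmod_lerB (x - zeta) (x - z); rewrite -/D [cmod (x - z)]cmodB zx.
    rewrite (_ : x - zeta - (x - z) = z - zeta); last by ring.
    lra.
  have zhi : cmod (z - zeta) < d3.
    have := cmodD (z - x) (x - zeta); rewrite zx -/D addrA subrK; lra.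
  have q3 : K * D ^+ k.+1 <= cmod (phi z - psi z).
    apply: le_trans _ (h3 z Dz zhi).
    have -> : K * D ^+ k.+1 = K' * (D / 2) ^+ k.+1.
      by rewrite KE expr_div_n mulrAC -mulrA.
    rewrite ler_pM2l // lerXn2r ?nnegrE ?cmod_ge0 //.
    by rewrite divr_ge0 ?ltW.
  have p1 : cmod (phi z) <= 1 by apply: ltW; exact: Dphi.
  have p2 : cmod (psi z) <= 1 by apply: ltW; exact: Dpsi.
  (* The values [phi z] and [psi z] are at least [K * D ^+ k.+1] apart, while [1 - |phi z|^2] is at
     most half of that by [q1] and [q6]. *)
  have q4 := one_sub_conjM_ge_sub p1 p2.
  have q5 : 1 - r ^+ 2 <= 2 * (D * M * D ^+ k.+1) by rewrite -rE expr2; nra.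
  have q6 : C * (1 - r ^+ 2) <= K / 2 * D ^+ k.+1.
    apply: le_trans (ler_wpM2l (ltW C0) q5) _.
    have -> : C * (2 * (D * M * D ^+ k.+1)) = (D * (4 * C * M)) / 2 * D ^+ k.+1.
      by field.
    by apply: ler_wpM2r; [exact: ltW|lra].
  have q7 : K / 2 * D ^+ k.+1 <= cmod (1 - Num.conj (phi z) * psi z).
    by rewrite -/C in q1; lra.
  apply: le_trans _ (ler_wpM2l (ltW e0) q7); apply: le_trans q5 _.
  have -> : 2 * (D * M * D ^+ k.+1) = (D * (4 * M)) / 2 * D ^+ k.+1 by field.
  have -> : e * (K / 2 * D ^+ k.+1) = e * K / 2 * D ^+ k.+1 by ring.
  by apply: ler_wpM2r; [exact: ltW|lra].
Qed.
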